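(* Let $N\ge2$ and let $\Omega\subset\mathbb{R}^N$ be a smooth bounded domain. Let $s\in(1,N)$ and let $s^*=\frac{sN}{N-s}$. For any $\varepsilon>0$ and any $u_0\in W_0^{1,s}(\Omega)$ there exist $\sigma>0$ and $r>0$ such that $$\int_{\{x\in\Omega:\,|u(x)|\ge\sigma\}}|u(x)|^{s^*}\,dx<\varepsilon$$ for every $u\in B_r(u_0)=\{u\in W_0^{1,s}(\Omega):\ \|u-u_0\|_{1,s}\le r\}$.
   Context: $\|\cdot\|_{1,s}$ denotes the usual norm of the Sobolev space $W_0^{1,s}(\Omega)$. *)

(* Defs.v *)
From HB Require Import structures.
From mathcomp Require Import all_boot all_order all_algebra.
From mathcomp Require Import all_classical all_reals all_analysis.
From mathcomp Require Import measurable_realfun.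
Set Implicit Arguments.
Unset Strict Implicit.
Unset Printing Implicit Defensive.
Import Order.TTheory GRing.Theory Num.Theory.
Import numFieldNormedType.Exports.
Local Open Scope classical_set_scope.
Local Open Scope ring_scope.

(** * Lebesgue measure on row vectors *)

Definition rV_display : measure_display.
Proof. exact: default_measure_display. Qed.

(* The product sigma-algebra, generated by the coordinates; it contains every
   open set, see [rV_open_measurable]. *)
Section measurable_rV.
Context {R : realType}.
Variable n : nat.

Let coors : 'I_n -> 'rV[R]_n -> measurableTypeR R := fun i v => v ord0 i.

Let rV_set0 : g_sigma_preimage coors set0.
Proof. exact: sigma_algebra0. Qed.

Let rV_setC A : g_sigma_preimage coors A -> g_sigma_preimage coors (~` A).
Proof. exact: sigma_algebraC. Qed.

Let rV_bigcup (F : (set 'rV[R]_n)^nat) :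
  (forall i, g_sigma_preimage coors (F i)) ->
  g_sigma_preimage coors (\bigcup_i F i).
Proof. exact: sigma_algebra_bigcup. Qed.

HB.instance Definition _ := @isMeasurable.Build rV_display
  'rV[R]_n (g_sigma_preimage coors) rV_set0 rV_setC rV_bigcup.

End measurable_rV.

Lemma measurable_coord (R : realType) n (i : 'I_n) :
  measurable_fun [set: 'rV[R]_n] (fun v => v ord0 i : measurableTypeR R).
Proof.
move=> _ Y mY; rewrite setTI; apply: sub_sigma_algebra => /=.
rewrite -bigcup_seq/=; exists i => /=; first by rewrite mem_index_enum.
by exists Y => //; rewrite setTI.
Qed.

Lemma measurable_fun_rVP d (S : measurableType d) (R : realType) n
    (f : S -> 'rV[R]_n) :
  (forall i, measurable_fun [set: S]
     (fun x => f x ord0 i : measurableTypeR R)) ->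
  measurable_fun [set: S] f.
Proof.
move=> mf.
pose G := \big[setU/set0]_(i < n)
  preimage_set_system setT (fun v : 'rV[R]_n => v ord0 i : measurableTypeR R)
    measurable.
apply: (@measurability _ _ _ _ _ _ G) => // _ [A + <-].
rewrite {}/G; case: n => [|n'] in f mf A *; first by rewrite big_ord0.
rewrite -bigcup_mkord_ord => -[i /= ltin [B mB <-]].
by have := mf (inord i) measurableT B mB; rewrite !setTI.
Qed.

Section lebesgue_rV.
Context {R : realType}.
Local Notation mR := (measurableTypeR R).

Definition rV_cons n (p : mR * 'rV[R]_n) : 'rV[R]_n.+1 :=
  \row_i oapp (p.2 ord0) p.1 (unlift ord0 i).

Definition rV_behead n (v : 'rV[R]_n.+1) : 'rV[R]_n :=
  \row_i v ord0 (lift ord0 i).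

Lemma rV_cons0 n p : @rV_cons n p ord0 ord0 = p.1.
Proof. by rewrite mxE unlift_none. Qed.

Lemma rV_consK n p : rV_behead (@rV_cons n p) = p.2.
Proof. by apply/rowP => i; rewrite !mxE liftK. Qed.

Lemma measurable_rV_cons n : measurable_fun [set: mR * 'rV[R]_n] (@rV_cons n).
Proof.
apply: measurable_fun_rVP => i; rewrite /rV_cons.
under eq_fun do rewrite mxE.
case: unliftP => [j _|_] /=; last exact: measurable_fst.
by apply: (measurableT_comp (measurable_coord j)); exact: measurable_snd.
Qed.

Lemma measurable_rV_behead n : measurable_fun [set: 'rV[R]_n.+1] (@rV_behead n).
Proof.
apply: measurable_fun_rVP => i; rewrite /rV_behead.
by under eq_fun do rewrite mxE; exact: measurable_coord.
Qed.

Section step.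
Variables (n : nat) (m : {sigma_finite_measure set 'rV[R]_n -> \bar R}).

Definition lebesgue_rVS : set 'rV[R]_n.+1 -> \bar R :=
  pushforward (@lebesgue_measure R \x m)%E (@rV_cons n).

Let lebesgue_rVS0 : lebesgue_rVS set0 = 0%E.
Proof. by rewrite /lebesgue_rVS /pushforward preimage_set0 measure0. Qed.

Let lebesgue_rVS_ge0 A : (0 <= lebesgue_rVS A)%E.
Proof. by apply: integral_ge0 => x _; exact: measure_ge0. Qed.

Let lebesgue_rVS_sigma_additive : semi_sigma_additive lebesgue_rVS.
Proof.
have mc A : measurable A -> measurable (@rV_cons n @^-1` A).
  by move=> mA; rewrite -[X in measurable X]setTI; exact: measurable_rV_cons.
move=> F mF tF mUF; rewrite /lebesgue_rVS /pushforward preimage_bigcup.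
apply: measure_semi_sigma_additive.
- by move=> k; exact: mc.
- apply/trivIsetP => /= i j _ _ ij; rewrite -preimage_setI.
  by move/trivIsetP : tF => /(_ _ _ _ _ ij) ->//; rewrite preimage_set0.
- by rewrite -preimage_bigcup; exact: mc.
Qed.

HB.instance Definition _ := isMeasure.Build _ _ _ lebesgue_rVS
  lebesgue_rVS0 lebesgue_rVS_ge0 lebesgue_rVS_sigma_additive.

Let lebesgue_rVS_sigma_finite : sigma_finite setT lebesgue_rVS.
Proof.
have /sigma_finiteP[F [TF ndF Foo]] := sigma_finiteT (@lebesgue_measure R).
have /sigma_finiteP[G [TG ndG Goo]] := sigma_finiteT m.
exists (fun k => (fun v : 'rV[R]_n.+1 => v ord0 ord0 : mR) @^-1` F k `&`
    @rV_behead n @^-1` G k).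
  rewrite predeqE => v; split => // _.
  have [k _ Fk] : (\bigcup_k F k) (v ord0 ord0) by rewrite -TF.
  have [l _ Gl] : (\bigcup_k G k) (rV_behead v).
    by rewrite -TG.
  exists (maxn k l) => //; split => /=.
  - by move: Fk; exact/subsetPset/ndF/leq_maxl.
  - by move: Gl; exact/subsetPset/ndG/leq_maxr.
move=> k; have [mF Fk] := Foo k; have [mG Gk] := Goo k; split.
  apply: measurableI; rewrite -[X in measurable X]setTI.
  - exact: measurable_coord.
  - exact: measurable_rV_behead.
rewrite /lebesgue_rVS /pushforward (_ : _ @^-1` _ = F k `*` G k).
  by rewrite product_measure1E// lte_mul_pinfty// ge0_fin_numE.
by apply/seteqP; split=> -[x v]; rewrite /= ?rV_cons0 ?rV_consK.
Qed.

HB.instance Definition _ := Measure_isSigmaFinite.Build _ _ _ lebesgue_rVS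
  lebesgue_rVS_sigma_finite.

End step.

Fixpoint lebesgue_rV n : {sigma_finite_measure set 'rV[R]_n -> \bar R} :=
  if n is n'.+1 then lebesgue_rVS (lebesgue_rV n')
  else @dirac _ 'rV[R]_0 0 R.

End lebesgue_rV.

Lemma rV_open_measurable (R : realType) n (U : set 'rV[R]_n) :
  open U -> measurable U.
Proof.
move=> oU.
pose B (p : 'rV[rat]_n * nat) : set 'rV[R]_n :=
  ball (map_mx (@ratr R) p.1) p.2.+1%:R^-1.
have mB p : measurable (B p).
  rewrite (_ : B p = \bigcap_(i in [set: 'I_n])
      ((fun v : 'rV[R]_n => v ord0 i : measurableTypeR R) @^-1`
        ball (ratr (p.1 ord0 i) : R) p.2.+1%:R^-1)).
    apply: fin_bigcap_measurable => // i _; rewrite -[X in measurable X]setTI.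
    by apply: measurable_coord => //; apply: open_measurable; exact: ball_open.
  apply/seteqP; split => [v [_ Bv] i _|v Bv].
    by have := Bv ord0 i; rewrite mxE.
  by split=> [//|i j]; rewrite (ord1 i) mxE; exact: Bv.
rewrite (_ : U = \bigcup_k (if unpickle k is Some p then
    if `[< B p `<=` U >] then B p else set0 else set0)).
  by apply: bigcupT_measurable => k; case: unpickle => // p; case: ifP.
apply/seteqP; split => [v Uv|v [k _]]; last first.
  by case: unpickle => // p; case: asboolP => // pU /pU.
have /nbhs_ballP[e /= e0 eU] : nbhs v U by exact: open_nbhs_nbhs.
have e20 : 0 < e / 2 by rewrite divr_gt0.
have [k _ /(_ _ (leqnn k)) ke] := near_infty_natSinv_lt (PosNum e20).
have /choice[q qv] i : exists q : rat,
    `|v ord0 i - ratr q| < k.+1%:R^-1 :> R.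
  have [|q] := @rat_in_itvoo R (v ord0 i - k.+1%:R^-1) (v ord0 i + k.+1%:R^-1).
    by rewrite ltrD2l gtrN.
  rewrite in_itv/= => /andP[q1 q2]; exists q.
  by rewrite ltr_distlC q1.
pose p : 'rV[rat]_n * nat := (\row_i q i, k).
have Bpv : B p v.
  split=> // i j; rewrite (ord1 i) !mxE /ball /= distrC; exact: qv.
exists (pickle p) => //; rewrite pickleK; case: asboolP => // -[].
move=> w Bpw; apply: eU; apply: (@le_ball _ _ _ (e / 2 + e / 2)).
  by rewrite -splitr.
apply: (@ball_triangle _ _ (map_mx (@ratr R) p.1)).
  by apply: ball_sym; apply: le_ball Bpv; exact: ltW.
by apply: le_ball Bpw; exact: ltW.
Qed.

Lemma lebesgue_rV_box (R : realType) n (a b : 'I_n -> R) :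
  (forall i, a i <= b i) ->
  lebesgue_rV n [set v | forall i, v ord0 i \in `[a i, b i]] =
  (\prod_(i < n) (b i - a i))%:E.
Proof.
elim: n a b => [|n IHn] a b ab /=.
  by rewrite big_ord0 diracE mem_set// => -[].
rewrite /lebesgue_rVS /pushforward big_ord_recl EFinM.
rewrite -(IHn (a \o lift ord0) (b \o lift ord0)) => [|i]; last exact: ab.
have mbox m (c d : 'I_m -> R) :
    measurable [set v : 'rV[R]_m | forall i, v ord0 i \in `[c i, d i]].
  rewrite (_ : [set v | _] = \bigcap_(i in [set: 'I_m])
      ((fun v : 'rV[R]_m => v ord0 i : measurableTypeR R) @^-1`
        [set` `[c i, d i]])).
    apply: fin_bigcap_measurable => // i _; rewrite -[X in measurable X]setTI.
    by apply: measurable_coord => //; exact: measurable_itv.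
  by apply/seteqP; split => [v cvd i _|v cvd i]; exact: cvd.
transitivity ((@lebesgue_measure R \x lebesgue_rV n)%E (
    [set` `[a ord0, b ord0]] `*` [set v : 'rV[R]_n |
    forall i, v ord0 i \in `[(a \o lift ord0) i, (b \o lift ord0) i]])).
  congr ((_ \x _)%E _).
  apply/seteqP; split => [[x v] /= xv|[x v] /= [xab vab] i].
    split=> [|i]; first by have := xv ord0; rewrite rV_cons0.
    by have := xv (lift ord0 i); rewrite mxE liftK.
  case: (unliftP ord0 i) => [j ->|->]; last by rewrite rV_cons0.
  by rewrite mxE liftK; exact: vab.
rewrite product_measure1E//; last exact: mbox.
congr (_ * _)%E.
apply: (etrans (lebesgue_measure_itv _)); rewrite /= lte_fin.
by have := ab ord0; case: ltgtP => // -> _; rewrite subrr.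
Qed.

(** * Smooth bounded domains *)

Section smooth.
Context {R : realType} {n : nat}.
Implicit Types (f : 'rV[R]_n -> R) (Omega : set 'rV[R]_n).

Definition partial (i : 'I_n) f : 'rV[R]_n -> R := 'D_(delta_mx ord0 i) f.

Fixpoint Ck k f : Prop :=
  continuous f /\
  if k is k'.+1 then
    forall i, (forall x, derivable f x (delta_mx ord0 i)) /\ Ck k' (partial i f)
  else True.

Definition smooth f := forall k, Ck k f.

End smooth.

(* Near each boundary point, up to the choice [i] of the vertical axis and its
   orientation [b], the set is the strict epigraph of a smooth function of the
   remaining coordinates; [col' i y] is [y] with its [i]-th entry removed. *)
Definition smooth_boundary {R : realType} {n} (Omega : set 'rV[R]_n) :=
  forall x, (closure Omega `\` interior Omega) x ->
  exists (i : 'I_n) (b : bool) (gamma : 'rV[R]_n.-1 -> R) (r : R),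
  [/\ smooth gamma, 0 < r & forall y, ball x r y ->
    (Omega y <-> gamma (col' i y) < (-1) ^+ b * y ord0 i)].

Definition smooth_bounded_domain {R : realType} {n} (Omega : set 'rV[R]_n) :=
  [/\ open Omega, connected Omega, Omega !=set0, bounded_set Omega &
      smooth_boundary Omega].

(** * Sobolev spaces *)

(* Functions on an open set [Omega] are represented by total functions whose
   values outside [Omega] are irrelevant: [f \_ Omega] is [f] extended by 0. *)
Section sobolev.
Context {R : realType} {n : nat}.
Variable Omega : set 'rV[R]_n.
Local Notation mu := (lebesgue_rV n : {measure set 'rV[R]_n -> \bar R}).
Implicit Types (f g u v phi : 'rV[R]_n -> R) (s : R).

Definition Lnorm_on s f : \bar R :=
  Lnorm mu s%:E (EFin \o (f \_ Omega)).

Definition Lspace_on s : set ('rV[R]_n -> R) :=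
  [set f | f \_ Omega \in Lfun mu s%:E].

(* C_c^oo(Omega), its elements being extended by 0 *)
Definition test_function : set ('rV[R]_n -> R) :=
  [set phi | [/\ smooth phi, compact (closure [set x | phi x != 0]) &
                 closure [set x | phi x != 0] `<=` Omega]].

Definition L1loc : set ('rV[R]_n -> R) :=
  [set f : 'rV[R]_n -> R | measurable_fun Omega f /\
    forall K, compact K -> K `<=` Omega ->
      (\int[mu]_(x in K) `|f x|%:E < +oo)%E].

Definition is_weak_partial (i : 'I_n) u g :=
  [/\ L1loc u, L1loc g & forall phi, test_function phi ->
    \int[mu]_(x in Omega) (u x * partial i phi x) =
    - \int[mu]_(x in Omega) (g x * phi x)].

(* A representative of the weak partial derivative, unique up to a.e. equality
   (and the zero function when there is no weak derivative). *)
Definition weak_partial (i : 'I_n) u : 'rV[R]_n -> R :=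
  xget (cst 0) [set g | is_weak_partial i u g].

(* W^{1,s}(Omega) *)
Definition W1 s : set ('rV[R]_n -> R) :=
  [set u | Lspace_on s u /\
    forall i, exists2 g, is_weak_partial i u g & Lspace_on s g].

(* Euclidean norm of the weak gradient *)
Definition weak_grad_norm u : 'rV[R]_n -> R :=
  fun x => Num.sqrt (\sum_(i < n) weak_partial i u x ^+ 2).

Definition W1_norm s u : \bar R :=
  (Lnorm_on s u + Lnorm_on s (weak_grad_norm u))%E.

(* W^{1,s}_0(Omega), the closure of C_c^oo(Omega) in W^{1,s}(Omega) *)
Definition W10 s : set ('rV[R]_n -> R) :=
  [set u | W1 s u /\ forall e : R, 0 < e ->
    exists2 phi, test_function phi & (W1_norm s (u \- phi)%R < e%:E)%E].

(* The usual norm on W^{1,s}_0(Omega) for bounded Omega; by Poincaré's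
   inequality it is equivalent to [W1_norm s] there. *)
Definition W10_norm s u : \bar R := Lnorm_on s (weak_grad_norm u).

Definition W10_ball s u0 (r : R) : set ('rV[R]_n -> R) :=
  [set u | W10 s u /\ (W10_norm s (u \- u0)%R <= r%:E)%E].

End sobolev.

(* Main.v *)
(** Fix a test function [psi] close to [u0] in [W^{1,s}] and let [|psi| <= M].
    For [u] in a small ball around [u0] and a test function [phi] very close to
    [u], the gradient of [phi - psi] is small in [L^s], hence so is
    [|phi - psi|^{s*}] in [L^1] by Sobolev's inequality at the critical
    exponent. Where [|u| >= 2 M + 1], either [|u| <= 4 |phi - psi|] or
    [|u| < 4 |u - phi|]; on [|u| <= m] the second alternative contributes at
    most a constant times [|u - phi|^s], which vanishes as [phi] tends to [u],
    and then [m] tends to infinity.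

    Sobolev's inequality for test functions is Gagliardo's: [|w|^g] is bounded
    by a line integral in each coordinate direction, and a Loomis-Whitney type
    inequality is proved by induction on the dimension. The classical gradient
    of [phi - psi] is compared with the weak gradients, which are only
    specified by duality, by testing against a smooth approximation of
    [|v|^(s - 2) v], where [v] is a classical partial derivative. *)
Require Import Defs.
From HB Require Import structures.
From mathcomp Require Import all_boot all_order all_algebra.
From mathcomp Require Import all_classical all_reals all_analysis.
From mathcomp Require Import measurable_realfun ring lra.
Import Order.TTheory GRing.Theory Num.Theory.
Import numFieldNormedType.Exports.
Set Implicit Arguments.
Unset Strict Implicit.
Unset Printing Implicit Defensive.
Local Open Scope classical_set_scope.
Local Open Scope ring_scope.

(** * Hölder's inequality for extended nonnegative functions *)

Section hoelder_poweR.
Context d {T : measurableType d} {R : realType}.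
Variable mu : {measure set T -> \bar R}.
Local Open Scope ereal_scope.

Let ae_eq_fine (f : T -> \bar R) : measurable_fun setT f ->
  (forall x, 0 <= f x) -> \int[mu]_x f x < +oo ->
  f = EFin \o (fine \o f) %[ae mu].
Proof.
move=> mf f0 fy.
have fi : mu.-integrable setT f.
  by apply/integrableP; split=> //; under eq_integral do rewrite gee0_abs//.
apply: filterS (integrable_ae measurableT fi) => x /= fx _.
by rewrite fineK//; exact: fx.
Qed.

(** Extended values are needed because the line integrals below may be infinite. Once zero and
    infinite integrals are set aside, both functions are finite almost everywhere, and the real
    inequality [hoelder] applies to [F] and [G] with exponents [1 / (1 - p)] and [1 / p]. *)
Lemma hoelder_poweR (f g : T -> \bar R) (p : R) :
  measurable_fun setT f -> measurable_fun setT g ->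
  (forall x, 0 <= f x) -> (forall x, 0 <= g x) -> (0 < p < 1)%R ->
  \int[mu]_x (f x `^ (1 - p) * g x `^ p) <=
  (\int[mu]_x f x) `^ (1 - p) * (\int[mu]_x g x) `^ p.
Proof.
move=> mf mg f0 g0 /andP[p0 p1].
have q0 : (0 < 1 - p)%R by rewrite subr_gt0.
have F0 : 0 <= \int[mu]_x f x by exact: integral_ge0.
have G0 : 0 <= \int[mu]_x g x by exact: integral_ge0.
have mfg : measurable_fun setT (fun x => f x `^ (1 - p) * g x `^ p).
  by apply: emeasurable_funM; exact: (measurableT_comp (measurable_poweR _)).
have zero (h : T -> \bar R) : measurable_fun setT h -> (forall x, 0 <= h x) ->
    \int[mu]_x h x = 0 -> h = cst 0 %[ae mu].
  move=> mh h0 hi; apply/(ae_eq_integral_abs mu measurableT mh).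
  by under eq_integral do rewrite gee0_abs//.
have [f_0|fn0] := eqVneq (\int[mu]_x f x) 0.
  rewrite f_0 poweR0r ?gt_eqF// mul0e.
  rewrite (ae_eq_integral (cst 0)) ?integral0//.
  apply: filterS (zero _ mf f0 f_0) => x /= + _ => ->//.
  by rewrite poweR0r ?gt_eqF// mul0e.
have [g_0|gn0] := eqVneq (\int[mu]_x g x) 0.
  rewrite g_0 [X in _ * X]poweR0r ?gt_eqF// mule0.
  rewrite (ae_eq_integral (cst 0)) ?integral0//.
  apply: filterS (zero _ mg g0 g_0) => x /= + _ => ->//.
  by rewrite [X in _ * X]poweR0r ?gt_eqF// mule0.
have fp : 0 < \int[mu]_x f x by rewrite lt0e fn0.
have gp : 0 < \int[mu]_x g x by rewrite lt0e gn0.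
have [fy|fy] := eqVneq (\int[mu]_x f x) +oo.
  by rewrite fy poweRyr ?gt_eqF// gt0_mulye ?leey// poweR_gt0.
have [gy|gy] := eqVneq (\int[mu]_x g x) +oo.
  by rewrite gy poweRyr ?gt_eqF// gt0_muley ?leey// poweR_gt0.
rewrite -ltey in fy; rewrite -ltey in gy.
have ff := ae_eq_fine mf f0 fy; have gg := ae_eq_fine mg g0 gy.
have mff : measurable_fun setT (fine \o f) by exact: measurableT_comp.
have mgg : measurable_fun setT (fine \o g) by exact: measurableT_comp.
pose F x := (fine (f x) `^ (1 - p))%R; pose G x := (fine (g x) `^ p)%R.
have mF : measurable_fun setT F by exact: (measurableT_comp (measurable_powR _)).
have mG : measurable_fun setT G by exact: (measurableT_comp (measurable_powR _)).
have := @hoelder _ _ _ mu F G (1 - p)^-1 p^-1 mF mG.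
rewrite !invr_gt0 !invrK => /(_ q0 p0 (subrK _ _)).
rewrite Lnorm1 unlock !invrK.
have -> : \int[mu]_x (`|(EFin \o F) x| `^ (1 - p)^-1) = \int[mu]_x f x.
  rewrite [RHS](ae_eq_integral (EFin \o (fine \o f)))//; last exact/measurable_EFinP.
  apply: eq_integral => x _ /=.
  rewrite ger0_norm ?powR_ge0// -powRrM divff ?gt_eqF// powRr1//.
  exact: fine_ge0.
have -> : \int[mu]_x (`|(EFin \o G) x| `^ p^-1) = \int[mu]_x g x.
  rewrite [RHS](ae_eq_integral (EFin \o (fine \o g)))//; last exact/measurable_EFinP.
  apply: eq_integral => x _ /=.
  rewrite ger0_norm ?powR_ge0// -powRrM divff ?gt_eqF// powRr1//.
  exact: fine_ge0.
apply: le_trans; rewrite le_eqVlt; apply/orP; left; apply/eqP.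
apply: ae_eq_integral => //.
  by do 2 apply: measurableT_comp => //; exact: measurable_funM.
apply: filterS2 ff gg => x /= fE gE _.
by rewrite fE// gE//= ger0_norm ?mulr_ge0 ?powR_ge0.
Qed.

End hoelder_poweR.

(** * Integrals along coordinate lines and a Loomis-Whitney type inequality *)

Section line_integral.
Context {R : realType}.
Local Notation mR := (measurableTypeR R).
Local Notation mu := (@lebesgue_measure R).
Local Open Scope ereal_scope.

Definition row_upd n (x : 'rV[R]_n) (i : 'I_n) (t : R) : 'rV[R]_n :=
  \row_j if j == i then t else x ord0 j.

Lemma row_updE n (x : 'rV[R]_n) i t j :
  row_upd x i t ord0 j = if j == i then t else x ord0 j.
Proof. by rewrite mxE. Qed.

Lemma row_upd_id n (x : 'rV[R]_n) i : row_upd x i (x ord0 i) = x.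
Proof. by apply/rowP => j; rewrite mxE; case: eqP => [->|]. Qed.

Lemma row_upd_cons0 n t (y : 'rV[R]_n) t' :
  row_upd (rV_cons (t, y)) ord0 t' = rV_cons (t', y).
Proof.
apply/rowP => j; rewrite !mxE; case: (unliftP ord0 j) => [k ->|->] //=.
Qed.

Lemma row_upd_consS n t (y : 'rV[R]_n) i t' :
  row_upd (rV_cons (t, y)) (lift ord0 i) t' = rV_cons (t, row_upd y i t').
Proof.
apply/rowP => j; rewrite !mxE; case: (unliftP ord0 j) => [k ->|->] /=.
  by rewrite mxE (inj_eq lift_inj).
by [].
Qed.

Lemma measurable_row_upd n (i : 'I_n) :
  measurable_fun setT (fun p : 'rV[R]_n * mR => row_upd p.1 i p.2).
Proof.
apply: measurable_fun_rVP => j; under eq_fun do rewrite row_updE.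
case: eqP => _; first exact: measurable_snd.
exact: (measurableT_comp (measurable_coord j)).
Qed.

Lemma measurable_rV_cons2 n (t : R) :
  measurable_fun setT (fun y : 'rV[R]_n => rV_cons (t, y)).
Proof.
by apply: (measurableT_comp (@measurable_rV_cons R n)); exact: measurable_pair1.
Qed.

(** Kept as a function on the whole space, constant in the [i]-th entry of [x], so that the line
    integrals in different directions can be multiplied pointwise. *)
Definition line_integral n (i : 'I_n) (f : 'rV[R]_n -> \bar R) x :=
  \int[mu]_t f (row_upd x i t).

Lemma line_integral_ge0 n (i : 'I_n) f x :
  (forall v, 0 <= f v) -> 0 <= line_integral i f x.
Proof. by move=> f0; exact: integral_ge0. Qed.

Lemma measurable_line_integral n (i : 'I_n) (f : 'rV[R]_n -> \bar R) :
  measurable_fun setT f -> (forall v, 0 <= f v) ->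
  measurable_fun setT (line_integral i f).
Proof.
move=> mf f0.
apply: (@measurable_fun_fubini_tonelli_F _ _ _ _ _ mu
  (fun p : 'rV[R]_n * mR => f (row_upd p.1 i p.2))) => //.
exact: (measurableT_comp mf (measurable_row_upd i)).
Qed.

Lemma line_integral_cons0 n (f : 'rV[R]_n.+1 -> \bar R) t y :
  line_integral ord0 f (rV_cons (t, y)) = \int[mu]_t' f (rV_cons (t', y)).
Proof. by apply: eq_integral => u _; rewrite row_upd_cons0. Qed.

Lemma line_integral_consS n i (f : 'rV[R]_n.+1 -> \bar R) t y :
  line_integral (lift ord0 i) f (rV_cons (t, y)) =
  line_integral i (fun z => f (rV_cons (t, z))) y.
Proof. by apply: eq_integral => u _; rewrite row_upd_consS. Qed.

Lemma integral_rVS n (f : 'rV[R]_n.+1 -> \bar R) :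
  measurable_fun setT f -> (forall v, 0 <= f v) ->
  \int[lebesgue_rV n.+1]_v f v =
  \int[mu]_t \int[lebesgue_rV n]_y f (rV_cons (t, y)).
Proof.
move=> mf f0.
transitivity (\int[mu \x lebesgue_rV n]_p (f \o @rV_cons R n) p).
  exact: (ge0_integral_pushforward (measurable_rV_cons (n := n))).
rewrite fubini_tonelli1//; last by move=> ?; exact: f0.
exact: (measurableT_comp mf (@measurable_rV_cons R n)).
Qed.

Lemma integral_rVS_swap n (f : 'rV[R]_n.+1 -> \bar R) :
  measurable_fun setT f -> (forall v, 0 <= f v) ->
  \int[lebesgue_rV n.+1]_v f v =
  \int[lebesgue_rV n]_y \int[mu]_t f (rV_cons (t, y)).
Proof.
move=> mf f0; rewrite integral_rVS//.
rewrite (@fubini_tonelli _ _ _ _ _ mu (lebesgue_rV n) (f \o @rV_cons R n))//;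
  last by move=> ?; exact: f0.
exact: (measurableT_comp mf (@measurable_rV_cons R n)).
Qed.

Lemma integral_rV0 (f : 'rV[R]_0 -> \bar R) : measurable_fun setT f ->
  \int[lebesgue_rV 0]_v f v = f 0%R.
Proof. by move=> mf; rewrite integral_dirac// diracT mul1e. Qed.

Lemma line_integral_rV1 i (f : 'rV[R]_1 -> \bar R) x :
  measurable_fun setT f -> (forall v, 0 <= f v) ->
  line_integral i f x = \int[lebesgue_rV 1]_v f v.
Proof.
move=> mf f0; rewrite integral_rVS// (ord1 i); apply: eq_integral => t _.
rewrite integral_rV0; last exact: (measurableT_comp mf (measurable_rV_cons2 _)).
congr f; apply/rowP => j; rewrite !mxE (ord1 j) /=.
by rewrite unlift_none.
Qed.

Lemma poweR_prod (I : Type) (s : seq I) (F : I -> \bar R) (r : R) :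
  (forall i, 0 <= F i) ->
  (\prod_(i <- s) F i) `^ r = \prod_(i <- s) (F i `^ r).
Proof.
move=> F0; elim: s => [|i s IHs]; first by rewrite !big_nil poweR1r.
by rewrite !big_cons poweRM ?IHs// prode_ge0.
Qed.

Lemma emeasurable_prod d (T : measurableType d) (I : Type) (s : seq I)
    (F : I -> T -> \bar R) : (forall i, measurable_fun setT (F i)) ->
  measurable_fun setT (fun x => \prod_(i <- s) F i x).
Proof.
move=> mF; elim: s => [|i s IHs]; under eq_fun do rewrite ?big_nil ?big_cons.
  exact: measurable_cst.
exact: emeasurable_funM.
Qed.

(* The interpolation between [\int f] and the Loomis-Whitney inequality (the
   case [n%:R * p = 1]) is what makes the induction on the dimension close. *)
Theorem line_integral_prod_le n (f : 'rV[R]_n.+1 -> \bar R) (p : R) :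
  measurable_fun setT f -> (forall v, 0 <= f v) ->
  (0 < p)%R -> (n%:R * p <= 1)%R ->
  \int[lebesgue_rV n.+1]_v
    (f v `^ (1 - n%:R * p) * \prod_(i < n.+1) (line_integral i f v `^ p)) <=
  (\int[lebesgue_rV n.+1]_v f v) `^ (1 + p).
Proof.
elim: n => [|n IHn] in f p *.
  move=> mf f0 p0 _.
  have F0 : 0 <= \int[lebesgue_rV 1]_v f v by exact: integral_ge0.
  rewrite mul0r subr0.
  under eq_integral.
    move=> v _; rewrite big_ord_recl big_ord0 mule1 poweRe1//.
    rewrite line_integral_rV1//; over.
  rewrite ge0_integralZr// ?poweR_ge0// -[X in X * _]poweRe1// -poweRD//.
  by apply: add_neq0_poweRD_def; rewrite gt_eqF// addr_gt0.
move=> mf f0 p0 np1.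
pose ft t y := f (rV_cons (t, y)).
have mft t : measurable_fun setT (ft t).
  exact: (measurableT_comp mf (measurable_rV_cons2 t)).
(* [g] is the line integral in the first direction; it does not depend on the slice [t]. *)
pose g y := \int[mu]_t f (rV_cons (t, y)).
have g0 y : 0 <= g y by exact: integral_ge0.
have mfc : measurable_fun setT (f \o @rV_cons R n.+1).
  exact: (measurableT_comp mf (@measurable_rV_cons R n.+1)).
have mg : measurable_fun setT g.
  exact: (@measurable_fun_fubini_tonelli_G _ _ _ _ _ mu (f \o @rV_cons R n.+1)
    mfc (fun=> f0 _)).
have mh : measurable_fun setT (fun t => \int[lebesgue_rV n.+1]_y ft t y).
  exact: (@measurable_fun_fubini_tonelli_F _ _ _ _ _ (lebesgue_rV n.+1)
    (f \o @rV_cons R n.+1) mfc (fun=> f0 _)).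
have fI : \int[lebesgue_rV n.+1]_y g y = \int[lebesgue_rV n.+2]_v f v.
  by rewrite [RHS]integral_rVS_swap.
have mprod m (h : 'rV[R]_m -> \bar R) (a b : R) : measurable_fun setT h ->
    (forall v, 0 <= h v) -> measurable_fun setT
    (fun v => h v `^ a * \prod_(i < m) (line_integral i h v `^ b)).
  move=> mh' h0; apply: emeasurable_funM.
    exact: (measurableT_comp (measurable_poweR _)).
  apply: emeasurable_prod => i.
  by apply: (measurableT_comp (measurable_poweR _)); exact: measurable_line_integral.
have pprod m (h : 'rV[R]_m -> \bar R) (a b : R) v :
    0 <= h v `^ a * \prod_(i < m) (line_integral i h v `^ b).
  by rewrite mule_ge0 ?poweR_ge0// prode_ge0// => i _; rewrite poweR_ge0.
rewrite integral_rVS//; last exact: mprod.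
have fI0 : 0 <= \int[lebesgue_rV n.+2]_v f v by exact: integral_ge0.
(* The right-hand side becomes the integral over [t] of the slice integrals of [f], times the
   constant [(\int f) ^ p], so it suffices to compare the two sides for each fixed [t]. *)
rewrite poweRD; last by apply: add_neq0_poweRD_def; rewrite gt_eqF// addr_gt0.
rewrite poweRe1// {1}integral_rVS// -ge0_integralZr//; last 2 first.
- by move=> t _; exact: integral_ge0.
- exact: poweR_ge0.
apply: ge0_le_integral => //.
- by move=> t _; exact: integral_ge0.
- exact: (@measurable_fun_fubini_tonelli_F _ _ _ _ _ (lebesgue_rV n.+1)
    ((fun v => f v `^ (1 - n.+1%:R * p) * \prod_(i < n.+2)
      (line_integral i f v `^ p)) \o @rV_cons R n.+1)
    (measurableT_comp (mprod _ _ _ _ mf f0) (@measurable_rV_cons R n.+1))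
    (fun=> pprod _ _ _ _ _)).
- exact: emeasurable_funM.
move=> t _.
under eq_integral.
  move=> y _; rewrite big_ord_recl line_integral_cons0 -/(g y).
  under eq_bigr do rewrite line_integral_consS.
  over.
rewrite -/(ft t).
(* Hölder's inequality needs [p < 1]. Otherwise [n.+1%:R * p <= 1] forces [n = 0] and [p = 1], where
   both sides are computed. *)
have [p1|] := ltP p 1%R; last first.
  move=> p1; have n0 : n = 0%N.
    apply/eqP; rewrite -leqn0 leqNgt; apply/negP => n0.
    have : (1 < n.+1%:R * p)%R.
      rewrite (lt_le_trans (_ : _ < n.+1%:R)%R) ?ltr1n//.
      by rewrite ler_peMr.
    by rewrite ltNge np1.
  subst n; have -> : p = 1%R by apply/eqP; rewrite eq_le p1 andbT -[p]mul1r.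
  rewrite mulr1 subrr.
  under eq_integral.
    move=> y _; rewrite poweRe0 mul1e big_ord_recl big_ord0 mule1.
    rewrite line_integral_rV1//; last by move=> v; exact: f0.
    rewrite !poweRe1//; last by apply: integral_ge0 => ? _; exact: f0.
    over.
  rewrite ge0_integralZr//; last by apply: integral_ge0 => ? _; exact: f0.
  by rewrite fI muleC poweRe1.
have q0 : (0 < 1 - p)%R by rewrite subr_gt0.
(* Factoring the exponent [1 - p] out of the slice turns [p] into [q] and [1 - n.+1%:R * p] into
   [1 - n%:R * q]. The condition [n%:R * q <= 1] of the induction hypothesis is then exactly
   [n.+1%:R * p <= 1]. *)
pose q := (p / (1 - p))%R.
have qE : (q * (1 - p) = p)%R by rewrite /q divfK ?gt_eqF.
under eq_integral.
  move=> y _.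
  rewrite muleCA muleC [X in X * _](_ : _ = (ft t y `^ (1 - n%:R * q) *
     \prod_(i < n.+1) (line_integral i (ft t) y `^ q)) `^ (1 - p)).
    over.
  rewrite poweRM ?poweR_ge0//; last by rewrite prode_ge0// => i _; rewrite poweR_ge0.
  rewrite -poweRrM poweR_prod; last by move=> i; rewrite poweR_ge0.
  congr (_ `^ _ * _).
    by rewrite mulrBl mul1r -mulrA qE -natr1; ring.
  by apply: eq_bigr => i _; rewrite -poweRrM qE.
apply: le_trans (hoelder_poweR _ (mprod _ _ _ _ (mft t) _) mg _ g0 _) _ => //.
- by move=> v; exact: f0.
- by rewrite p0.
rewrite fI lee_wpmul2r ?poweR_ge0//.
have ft0 : 0 <= \int[lebesgue_rV n.+1]_v ft t v.
  by apply: integral_ge0 => v _; exact: f0.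
apply: (@le_trans _ _ (((\int[lebesgue_rV n.+1]_v ft t v) `^ (1 + q)) `^ (1 - p))).
  apply: gt0_ler_poweR; rewrite ?(ltW q0)//.
  - by rewrite in_itv/= leey andbT integral_ge0// => v _; exact: pprod.
  - by rewrite in_itv/= leey andbT poweR_ge0.
  apply: IHn => //.
  - by move=> v; exact: f0.
  - by rewrite divr_gt0.
  by rewrite mulrA ler_pdivrMr// mul1r lerBrDr; move: np1; rewrite -natr1 mulrDl mul1r.
(* Since [(1 + q) * (1 - p) = 1], the slice integral comes out with exponent one. *)
by rewrite -poweRrM mulrDl qE mul1r subrK poweRe1.
Qed.

End line_integral.

(** * Calculus of [|y| ^ r] on the line *)

Section one_variable.
Context {R : realType}.
Local Notation mR := (measurableTypeR R).
Local Notation mu := (@lebesgue_measure R).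
Implicit Types (y r g a b : R).

Lemma cvg_norm_powR0 r : 0 < r -> `|y| `^ r @[y --> (0 : R)] --> (0 : R).
Proof.
move=> r0; apply/cvgr0Pnorm_lt => e e0.
exists (e `^ r^-1) => /= [|y]; first by rewrite powR_gt0.
rewrite /ball_/= sub0r normrN (ger0_norm (powR_ge0 _ _)) => /(gt0_ltr_powR r0).
rewrite !nnegrE normr_ge0 powR_ge0 => /(_ isT isT).
by rewrite -powRrM mulVf ?gt_eqF// powRr1// ltW.
Qed.

Lemma derivable1_cvg (f : R -> R) y :
  derivable f y (1 : R) -> f z @[z --> y] --> f y.
Proof. by move=> /derivable1_diffP /differentiable_continuous. Qed.

(** Up to a factor, this is the derivative of a power of the absolute value; its continuity is what
    the fundamental theorem of calculus asks for. *)
Lemma continuous_sg_norm_powR r : 0 < r ->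
  continuous (fun y => Num.sg y * `|y| `^ r).
Proof.
move=> r0 y; have [y0|y0|->] := ltgtP y 0.
- have c : (fun z : R => - (- z) `^ r) z @[z --> y] --> - (- y) `^ r.
    apply: cvgN; apply: (@continuous_cvg _ _ _ _ _ _ (fun z => z `^ r)).
      apply: derivable1_cvg.
      by apply: derivable_powR; rewrite in_itv/= andbT oppr_gt0.
    exact: cvgN.
  rewrite /continuous_at ltr0_sg// ltr0_norm// mulN1r.
  apply: cvg_trans c; apply: near_eq_cvg; near=> z.
  have z0 : z < 0 by near: z; exact: lt_nbhsl.
  by rewrite ltr0_sg// ltr0_norm// mulN1r.
- have c : (fun z : R => z `^ r) z @[z --> y] --> y `^ r.
    apply: derivable1_cvg.
    by apply: derivable_powR; rewrite in_itv/= andbT.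
  rewrite /continuous_at gtr0_sg// gtr0_norm// mul1r.
  apply: cvg_trans c; apply: near_eq_cvg; near=> z.
  have z0 : 0 < z by near: z; exact: lt_nbhsr.
  by rewrite gtr0_sg// gtr0_norm// mul1r.
- rewrite /continuous_at sgr0 mul0r; apply/norm_cvg0P.
  apply: (@squeeze_cvgr _ _ _ _ (cst 0) (fun z => `|z| `^ r)).
  + near=> z; rewrite normr_ge0/= normrM (ger0_norm (powR_ge0 _ _)).
    by rewrite ler_piMl ?powR_ge0// normr_sg; case: (z != 0); rewrite ?ler01.
  + exact: cvg_cst.
  + exact: cvg_norm_powR0.
Unshelve. all: end_near. Qed.

Lemma is_derive_norm_powR y r : 1 < r ->
  is_derive y 1 (fun z : R => `|z| `^ r) (r * (Num.sg y * `|y| `^ (r - 1))).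
Proof.
move=> r1; have r0 : 0 < r by exact: lt_trans r1.
have [y0|y0|->] := ltgtP y 0.
- apply: (@near_eq_is_derive _ _ _ (fun z => (- z) `^ r)).
  + by near=> z; rewrite ltr0_norm//; near: z; exact: lt_nbhsl.
  + rewrite ltr0_sg// ltr0_norm//.
    have Ny0 : 0 < - y by rewrite oppr_gt0.
    have h1 := is_derive1_powR r Ny0.
    have h2 : is_derive y 1 (fun z : R => - z) (- 1) by apply: is_deriveN.
    have := is_derive1_comp h1 h2.
    by rewrite mulrN1 mulN1r mulrN.
- apply: (@near_eq_is_derive _ _ _ (fun z => z `^ r)).
  + by near=> z; rewrite gtr0_norm//; near: z; exact: lt_nbhsr.
  + by rewrite gtr0_sg// gtr0_norm// mul1r; exact: is_derive1_powR.
- rewrite sgr0 mul0r mulr0.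
  (* At [0] the difference quotient has absolute value [|h| ^ (r - 1)], which tends to 0 because
     [r > 1]. *)
  have c : h^-1 *: ((fun z : R => `|z| `^ r) (h *: 1 + 0) -
      (fun z : R => `|z| `^ r) 0) @[h --> (0 : R)^'] --> (0 : R).
    apply/norm_cvg0P.
    have : `|y| `^ (r - 1) @[y --> (0 : R)^'] --> (0 : R).
      apply: cvg_trans (cvg_norm_powR0 (r := r - 1) _); rewrite ?subr_gt0//.
      by apply: cvg_app; exact: nbhs_dnbhs.
    apply: cvg_trans; apply: near_eq_cvg; near=> h.
    have h0 : h != 0 by near: h; exact: nbhs_dnbhs_neq.
    rewrite /= addr0 normr0 powR0 ?gt_eqF// subr0 normrM normfV.
    rewrite /GRing.scale/= mulr1 (ger0_norm (powR_ge0 _ _)).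
    by rewrite powRB ?normr_eq0 ?h0 ?implybT// powRr1// mulrC.
  by split; [apply/cvg_ex; exists 0|exact/cvg_lim].
Unshelve. all: end_near. Qed.

Local Open Scope ereal_scope.

Lemma integral_is_derive (g dg : R -> R) a b : (a < b)%R ->
  (forall t, is_derive t (1%R : R) g (dg t)) -> continuous dg ->
  \int[mu]_(t in `[a, b]) (dg t)%:E = (g b)%:E - (g a)%:E.
Proof.
move=> ab gd cd.
have cg : continuous g.
  by move=> t; apply: derivable1_cvg; case: (gd t).
apply: continuous_FTC2 => //.
- exact: continuous_subspaceT.
- split.
  + by move=> t _; case: (gd t).
  + exact: cvg_at_right_filter (cg a).
  + exact: cvg_at_left_filter (cg b).
- by move=> t _; rewrite derive1E; case: (gd t).
Qed.

Lemma integral_is_derive_cpt (g dg : R -> R) a : (0 < a)%R ->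
  (forall t, is_derive t (1%R : R) g (dg t)) -> continuous dg ->
  (forall t, (a <= `|t|)%R -> g t = 0%R) ->
  (forall t, (a <= `|t|)%R -> dg t = 0%R) ->
  \int[mu]_t (dg t)%:E = 0.
Proof.
move=> a0 gd cd gz dz.
have aa : (- a < a)%R by rewrite gtrN.
have := integral_is_derive aa gd cd.
have -> : (g a)%:E - (g (- a)%R)%:E = 0.
  by rewrite !gz ?normrN ?ger0_norm ?(ltW a0)// subee.
move=> <-.
rewrite [RHS]integral_mkcond; apply: eq_integral => t _.
rewrite patchE; case: ifPn => //; rewrite notin_setE/= in_itv/= => /negP.
by rewrite -ler_norml -ltNge => /ltW ta; rewrite dz.
Qed.

(** The fundamental theorem of calculus for [|g| ^ r], started where [g] vanishes; the integral of
    the absolute value of the derivative is then extended to the whole line. *)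
Lemma norm_powR_le_integral (g dg : R -> R) r a b : (1 < r)%R ->
  (forall t, is_derive t (1%R : R) g (dg t)) -> continuous dg ->
  (forall t, (t <= b)%R -> g t = 0%R) ->
  (`|g a| `^ r)%:E <= \int[mu]_t (r * (`|g t| `^ (r - 1) * `|dg t|))%:E.
Proof.
move=> r1 gd cd gz; have r0 : (0 < r)%R by exact: lt_trans r1.
have r10 : (0 < r - 1)%R by rewrite subr_gt0.
have cg : continuous g.
  by move=> t; apply: derivable1_cvg; case: (gd t).
pose F t := (`|g t| `^ r)%R.
pose f t := (r * (Num.sg (g t) * `|g t| `^ (r - 1)) * dg t)%R.
have Ff t : is_derive t (1%R : R) F (f t).
  exact: is_derive1_comp (is_derive_norm_powR (g t) r1) (gd t).
have csg : continuous ((fun y => Num.sg y * `|y| `^ (r - 1))%R \o g).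
  by move=> t; apply: continuous_comp; [exact: cg|exact: continuous_sg_norm_powR].
have cf : continuous f.
  move=> t; apply: cvgM; last exact: cd.
  apply: cvgM; first exact: cvg_cst.
  exact: csg.
have mf : measurable_fun [set: mR] (f : mR -> mR).
  exact: continuous_measurable_fun.
(* The starting point lies below [b], where [g] vanishes, and strictly below [a], so that the
   interval is nondegenerate. *)
pose c := Num.min b (a - 1)%R.
have ca : (c < a)%R by rewrite gt_min ltrBlDr ltrDl ltr01 orbT.
have gc : g c = 0%R by rewrite gz// ge_min lexx.
have := integral_is_derive ca Ff cf.
rewrite /F gc normr0 powR0 ?gt_eqF// sube0 => <-.
have fE t : `|(f t)%:E| = (r * (`|g t| `^ (r - 1) * `|dg t|))%:E.
  rewrite /= /f !normrM (gtr0_norm r0) (ger0_norm (powR_ge0 _ _)) normr_sg.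
  rewrite -!mulrA; have [->|/=] := eqVneq (g t) 0%R; last by rewrite mul1r.
  by rewrite normr0 powR0 ?gt_eqF// !mul0r.
apply: (@le_trans _ _ (\int[mu]_(t in `[c, a]) `|(f t)%:E|)).
  apply: le_trans (lee_abs _) _; apply: le_abse_integral => //.
  by apply/measurable_EFinP; exact: measurable_funTS.
under [leRHS]eq_integral do rewrite -fE.
apply: ge0_subset_integral => //.
by apply: measurableT_comp => //; exact/measurable_EFinP.
Qed.

End one_variable.

(** * Closure properties of smooth functions *)

Section smooth_functions.
Context {R : realType} {n : nat}.
Implicit Types (f g v : 'rV[R]_n -> R) (i : 'I_n).
Local Notation dl i := (delta_mx ord0 i : 'rV[R]_n).

Lemma row_updD (x : 'rV[R]_n) i t h :
  row_upd x i (h + t) = h *: dl i + row_upd x i t.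
Proof.
apply/rowP => j; rewrite !mxE eqxx /=; case: eqP => _.
  by rewrite mulr1.
by rewrite mulr0 add0r.
Qed.

(** The two difference quotients are the same function of [h]; this transfers one-variable calculus
    to partial derivatives. *)
Lemma is_derive_row_upd (x : 'rV[R]_n) i f (t d : R) :
  is_derive t (1 : R) (fun u => f (row_upd x i u)) d <->
  is_derive (row_upd x i t) (dl i) f d.
Proof.
have E : (fun h => h^-1 *: (((fun u => f (row_upd x i u)) \o shift t) (h *: (1 : R)) -
      f (row_upd x i t))) =
    (fun h => h^-1 *: ((f \o shift (row_upd x i t)) (h *: dl i) -
      f (row_upd x i t))).
  apply/funext => h; congr (_ *: (_ - _)).
  by rewrite /= /shift/= [h *: 1]mulr1 row_updD.
by split=> -[dv <-]; split; rewrite /derivable /derive; move: dv;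
  rewrite /derivable ?E// -E.
Qed.

Lemma partial_comp (h : R -> R) f i x (d : R) :
  derivable f x (dl i) -> is_derive (f x) (1 : R) h d ->
  is_derive x (dl i) (h \o f) (d * partial i f x).
Proof.
move=> /derivableP df dh; rewrite -(row_upd_id x i) in df dh *.
apply/is_derive_row_upd; move/is_derive_row_upd in df.
exact: is_derive1_comp dh df.
Qed.

Lemma Ck_continuous k f : Ck k f -> continuous f.
Proof. by case: k => [|k] []. Qed.

Lemma CkS k f : Ck k.+1 f -> Ck k f.
Proof.
elim: k f => [|k IHk] f [cf df]; first by split.
by split=> // i; have [dfi cfi] := df i; split=> //; exact: IHk.
Qed.

Lemma Ck_intro k f (df : 'I_n -> 'rV[R]_n -> R) : continuous f ->
  (forall i x, is_derive x (dl i) f (df i x)) -> (forall i, Ck k (df i)) ->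
  Ck k.+1 f.
Proof.
move=> cf fd cdf; split=> // i; split=> [x|]; first by case: (fd i x).
rewrite (_ : partial i f = df i)//; apply/funext => x.
by have [_] := fd i x.
Qed.

Lemma Ck_derive k f i x : Ck k.+1 f -> is_derive x (dl i) f (partial i f x).
Proof. by move=> [_ /(_ i)[+ _]] => /(_ x) /derivableP. Qed.

Lemma Ck_partial k f i : Ck k.+1 f -> Ck k (partial i f).
Proof. by move=> [_ /(_ i)[]]. Qed.

Let contD f g : continuous f -> continuous g -> continuous (fun x => f x + g x).
Proof. by move=> cf cg x; exact: (continuousD (cf x) (cg x)). Qed.

Let contM f g : continuous f -> continuous g -> continuous (fun x => f x * g x).
Proof. by move=> cf cg x; exact: (continuousM (cf x) (cg x)). Qed.

Lemma Ck_cst k (c : R) : Ck k (fun _ : 'rV[R]_n => c).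
Proof.
elim: k c => [|k IHk] c; first by split=> //; exact: cst_continuous.
apply: (@Ck_intro _ _ (fun _ _ => 0)) => //.
- exact: cst_continuous.
Qed.

Lemma CkD k f g : Ck k f -> Ck k g -> Ck k (fun x => f x + g x).
Proof.
elim: k f g => [|k IHk] f g cf cg.
  exact: (conj (contD (Ck_continuous cf) (Ck_continuous cg)) I).
apply: (@Ck_intro _ _ (fun i x => partial i f x + partial i g x)).
- exact: (contD (Ck_continuous cf) (Ck_continuous cg)).
- by move=> i x; exact: (is_deriveD (Ck_derive i x cf) (Ck_derive i x cg)).
- by move=> i; exact: (IHk _ _ (Ck_partial i cf) (Ck_partial i cg)).
Qed.

Lemma CkM k f g : Ck k f -> Ck k g -> Ck k (fun x => f x * g x).
Proof.
elim: k f g => [|k IHk] f g cf cg.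
  exact: (conj (contM (Ck_continuous cf) (Ck_continuous cg)) I).
apply: (@Ck_intro _ _ (fun i x => f x * partial i g x + g x * partial i f x)).
- exact: (contM (Ck_continuous cf) (Ck_continuous cg)).
- by move=> i x; exact: (is_deriveM (Ck_derive i x cf) (Ck_derive i x cg)).
- move=> i; apply: CkD.
    exact: (IHk _ _ (CkS cf) (Ck_partial i cg)).
  exact: (IHk _ _ (CkS cg) (Ck_partial i cf)).
Qed.

(** The induction on [k] is made for all exponents at once, since differentiation lowers [r] by one;
    positivity of [f] keeps the power differentiable. *)
Lemma Ck_powR k f (r : R) : (forall x, 0 < f x) -> smooth f ->
  Ck k (fun x => f x `^ r).
Proof.
move=> f0 sf.
have D s i x : is_derive x (dl i) (fun y => f y `^ s)
    (s * f x `^ (s - 1) * partial i f x).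
  apply: (@partial_comp (fun t => t `^ s)); last exact: is_derive1_powR.
  by have [] := Ck_derive i x (sf 1%N).
have C s : continuous (fun x => f x `^ s).
  move=> x; apply: (@continuous_comp _ _ _ f (fun t => t `^ s)).
    exact: (Ck_continuous (sf 0%N)).
  by apply: derivable1_cvg; case: (is_derive1_powR s (f0 x)).
elim: k r => [|k IHk] r; first by split.
apply: (Ck_intro (C r) (D r)) => i.
apply: CkM; last exact: (Ck_partial i (sf k.+1)).
by apply: CkM => //; exact: Ck_cst.
Qed.

Lemma smooth_cst (c : R) : smooth (fun _ : 'rV[R]_n => c).
Proof. by move=> k; exact: Ck_cst. Qed.

Lemma smoothD f g : smooth f -> smooth g -> smooth (fun x => f x + g x).
Proof. by move=> sf sg k; exact: CkD. Qed.

Lemma smoothM f g : smooth f -> smooth g -> smooth (fun x => f x * g x).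
Proof. by move=> sf sg k; exact: CkM. Qed.

Lemma smoothN f : smooth f -> smooth (fun x => - f x).
Proof.
move=> sf; rewrite (_ : (fun x => - f x) = (fun x => -1 * f x)).
  by apply: smoothM => //; exact: smooth_cst.
by apply/funext => x; rewrite mulN1r.
Qed.

Lemma smoothB f g : smooth f -> smooth g -> smooth (f \- g).
Proof. by move=> sf sg; apply: smoothD => //; exact: smoothN. Qed.

Lemma smoothX f m : smooth f -> smooth (fun x => f x ^+ m).
Proof.
move=> sf; elim: m => [|m IHm].
  by under eq_fun do rewrite expr0; exact: smooth_cst.
by under eq_fun do rewrite exprS; exact: smoothM.
Qed.

Lemma smooth_powR f (r : R) : (forall x, 0 < f x) -> smooth f ->
  smooth (fun x => f x `^ r).
Proof. by move=> f0 sf k; exact: Ck_powR. Qed.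

Lemma smooth_partial f i : smooth f -> smooth (partial i f).
Proof. by move=> sf k; apply: Ck_partial; exact: sf. Qed.

Lemma smooth_continuous f : smooth f -> continuous f.
Proof. by move=> /(_ 0%N)[]. Qed.

Lemma smooth_derive f i x : smooth f -> is_derive x (dl i) f (partial i f x).
Proof. by move=> /(_ 1%N); exact: Ck_derive. Qed.

Lemma partialM f g i : smooth f -> smooth g ->
  partial i (fun x => f x * g x) =
  (fun x => f x * partial i g x + g x * partial i f x).
Proof.
move=> sf sg; apply/funext => x.
have [_] := is_deriveM (smooth_derive i x sf) (smooth_derive i x sg).
by [].
Qed.

Lemma measurable_continuous_rV f : continuous f ->
  measurable_fun setT (f : 'rV[R]_n -> measurableTypeR R).
Proof.
move=> /continuousP cf; apply: (measurability _ (RGenOpens.measurableE R)).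
move=> _ [_ [a [b ->] <-]]; rewrite setTI; apply: rV_open_measurable.
exact/cf/interval_open.
Qed.

Lemma measurable_smooth f : smooth f ->
  measurable_fun setT (f : 'rV[R]_n -> measurableTypeR R).
Proof. by move/smooth_continuous/measurable_continuous_rV. Qed.

Lemma continuous_row_upd (x : 'rV[R]_n) i : continuous (row_upd x i).
Proof.
move=> t A /nbhs_ballP[e /= e0 eA]; apply/nbhs_ballP; exists e => //= u tu.
apply: eA; split=> // a j; rewrite (ord1 a) !mxE; case: eqP => // _.
exact: ballxx.
Qed.

End smooth_functions.

(** * Test functions, compact sets and local integrability *)

Section compact_support.
Context {R : realType} {n : nat}.
Implicit Types (f g phi psi : 'rV[R]_n -> R) (i : 'I_n) (Omega K : set 'rV[R]_n).
Local Notation mR := (measurableTypeR R).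
Local Notation mu := (lebesgue_rV n : {measure set 'rV[R]_n -> \bar R}).
Local Notation supp f := (closure [set x | f x != 0]).

Let closure_sub_closed (A B : set 'rV[R]_n) :
  closed B -> A `<=` B -> closure A `<=` B.
Proof. by move=> cB AB; rewrite [B]((closure_id B).1 cB); exact: closure_subset. Qed.

Lemma notin_supp f x : ~ supp f x -> f x = 0.
Proof.
move=> Nfx; apply/eqP; apply: contrapT => fx.
by apply: Nfx; apply: subset_closure; apply/negP.
Qed.

Lemma notin_supp_partial f i x : ~ supp f x -> partial i f x = 0.
Proof.
move=> Nfx; rewrite /partial (@near_eq_derive _ _ _ f (cst 0)) ?derive_cst//.
have : open (~` supp f) by apply: closed_openC; exact: closed_closure.
rewrite openE => /(_ x Nfx); apply: filterS => y; exact: notin_supp.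
Qed.

Lemma supp_subset f g : (forall x, g x != 0 -> supp f x) -> supp g `<=` supp f.
Proof. by move=> gf; apply: closure_sub_closed => //; exact: closed_closure. Qed.

Lemma test_function_supp Omega f g : test_function Omega f -> smooth g ->
  (forall x, ~ supp f x -> g x = 0) -> test_function Omega g.
Proof.
move=> [sf cf fO] sg fg.
have gf : supp g `<=` supp f.
  by apply: supp_subset => x; apply: contra_neqP => /fg.
split=> //; last exact: subset_trans fO.
by apply: subclosed_compact gf => //; exact: closed_closure.
Qed.

Lemma test_partial Omega f i : test_function Omega f ->
  test_function Omega (partial i f).
Proof.
move=> tf; apply: (test_function_supp tf).
  by case: tf => sf _ _; exact: smooth_partial.
by move=> x; exact: notin_supp_partial.
Qed.

Lemma test_mulr Omega f g : test_function Omega f -> smooth g ->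
  test_function Omega (fun x => f x * g x).
Proof.
move=> tf sg; apply: (test_function_supp tf); first by case: tf => sf _ _; exact: smoothM.
by move=> x /notin_supp ->; rewrite mul0r.
Qed.

Lemma test_sub Omega f g : test_function Omega f -> test_function Omega g ->
  test_function Omega (f \- g).
Proof.
move=> [sf cf fO] [sg cg gO].
have h : supp (f \- g) `<=` supp f `|` supp g.
  apply: closure_sub_closed; first by apply: closedU; exact: closed_closure.
  move=> x /= fgx; apply: contrapT => /not_orP[/notin_supp fx /notin_supp gx].
  by move: fgx; rewrite fx gx subrr eqxx.
split; first exact: smoothB.
- apply: subclosed_compact h; first exact: closed_closure.
  exact: compactU.
- by move=> x /h[/fO|/gO].
Qed.

Lemma test_bounded Omega f : test_function Omega f ->
  exists2 M : R, 0 < M & forall x, `|f x| <= M.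
Proof.
move=> [sf cf _].
have : bounded_set (f @` supp f).
  apply: (@compact_bounded R R^o); apply: continuous_compact => //.
  by apply: continuous_subspaceT; exact: smooth_continuous.
rewrite /bounded_set/bounded_near => /pinfty_ex_gt0[M M0 fM].
exists M => // x; have [fx|/notin_supp ->] := pselect (supp f x).
  by apply: fM; exists x.
by rewrite normr0 ltW.
Qed.

Lemma ler_coord_norm (x : 'rV[R]_n) i : `|x ord0 i| <= `|x|.
Proof.
rewrite [leRHS]mx_normrE.
exact: (le_bigmax _ (fun ij => `|x ij.1 ij.2|) (ord0, i)).
Qed.

Lemma compact_box K : compact K ->
  exists2 B : R, 0 < B & forall x, K x -> forall i, `|x ord0 i| < B.
Proof.
move=> /compact_bounded; rewrite /bounded_set/bounded_near => /pinfty_ex_gt0[M M0 KM].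
exists (M + 1) => [|x Kx i]; first by rewrite addr_gt0.
apply: le_lt_trans (ler_coord_norm x i) _.
by rewrite (le_lt_trans (KM _ Kx))// ltrDl.
Qed.

Lemma compact_measurable_rV K : compact K -> measurable K.
Proof.
move=> cK; rewrite -(setCK K); apply: measurableC.
apply: rV_open_measurable; apply: closed_openC.
by apply: compact_closed => //; exact: norm_hausdorff.
Qed.

Lemma compact_finite_measure_rV K : compact K -> (mu K < +oo)%E.
Proof.
move=> cK; have [B B0 KB] := compact_box cK.
pose D := [set v : 'rV[R]_n | forall i, v ord0 i \in `[- B, B]].
have mD : measurable D.
  rewrite (_ : D = \bigcap_(i in [set: 'I_n])
      ((fun v : 'rV[R]_n => v ord0 i : mR) @^-1` [set` `[- B, B]])).
    apply: fin_bigcap_measurable => // i _; rewrite -[X in measurable X]setTI.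
    by apply: measurable_coord => //; exact: measurable_itv.
  by apply/seteqP; split => [v cvd i _|v cvd i]; exact: cvd.
apply: (@le_lt_trans _ _ (mu D)).
  apply: le_measure; rewrite ?inE//; first exact: compact_measurable_rV.
  by move=> x Kx i; rewrite in_itv/= -ler_norml ltW// KB.
have DE : lebesgue_rV n D = (\prod_(i < n) (B - (- B)))%:E.
  apply: (@lebesgue_rV_box R n (fun=> - B) (fun=> B)) => _.
  by rewrite lerNl (le_trans _ (ltW B0))// oppr_le0 ltW.
by have := ltry (\prod_(i < n) (B - (- B))); rewrite -DE.
Qed.

Lemma continuous_L1loc Omega f : measurable Omega -> continuous f -> L1loc Omega f.
Proof.
move=> mO cf; have mf := measurable_continuous_rV cf.
split; first exact: measurable_funTS.
move=> K cK _.
have : mu.-integrable K (EFin \o f).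
  apply: measurable_bounded_integrable.
  - exact: compact_measurable_rV.
  - exact: compact_finite_measure_rV.
  - exact: measurable_funTS.
  - have : bounded_set (f @` K).
      apply: (@compact_bounded R R^o); apply: continuous_compact => //.
      exact: continuous_subspaceT.
    rewrite /bounded_set/bounded_near; apply: filterS => M h x Kx.
    by apply: h; exists x.
by move=> /integrableP[_].
Qed.

(** On the support of [f], a compact subset of [Omega], the product is dominated by a constant times
    [|u|]; elsewhere it vanishes. *)
Lemma integrable_test_mul Omega u f : measurable Omega -> L1loc Omega u ->
  test_function Omega f -> mu.-integrable Omega (fun x => (u x * f x)%:E).
Proof.
move=> mO [mu_ iu] tf; have [M M0 fM] := test_bounded tf.
have [sf cf fO] := tf.
have mK := compact_measurable_rV cf.
have iK : mu.-integrable (supp f) (fun x => (u x)%:E).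
  apply/integrableP; split; last exact: iu.
  by apply/measurable_EFinP; exact: measurable_funS mu_.
have iKM : mu.-integrable (supp f) (fun x => (M%:E * (u x)%:E)%E).
  exact: integrableZl.
have mf := measurable_funTS (D := Omega) (measurable_smooth sf).
apply/integrableP; split; first by apply/measurable_EFinP; exact: measurable_funM.
move/integrableP : iKM => [_]; apply: le_lt_trans.
rewrite [leLHS]integral_mkcond [leRHS]integral_mkcond.
have m1 : measurable_fun setT (((fun x => `|(u x * f x)%:E|%E) \_ Omega) : _ -> \bar R).
  apply/(measurable_restrictT _ mO); apply: measurableT_comp => //.
  by apply/measurable_EFinP; exact: measurable_funM.
apply: ge0_le_integral => //.
- by move=> x _; rewrite patchE; case: ifP.
- apply/(measurable_restrictT _ mK); apply: measurableT_comp => //.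
  apply/measurable_EFinP; apply: measurable_funM => //.
  exact: measurable_funS mu_.
- move=> x _; rewrite !patchE; case: ifPn => [xO|_]; last first.
    by case: ifPn => _; [exact: abse_ge0|].
  case: ifPn => [xs|]; last first.
    by rewrite notin_setE => /notin_supp ->; rewrite /= mulr0 normr0.
  by rewrite lee_fin mulrC !normrM (gtr0_norm M0) ler_wpM2r.
Qed.

End compact_support.

(** * The integral of a partial derivative of a test function is zero *)

Section integration_by_parts.
Context {R : realType}.
Local Notation mR := (measurableTypeR R).

(* Splitting [G] into its positive and negative parts keeps the induction on
   the dimension within Tonelli's theorem for nonnegative functions. *)
Lemma integral_partial_pos_neg n (i : 'I_n) (f G : 'rV[R]_n -> R) (B : R) :
  0 < B -> measurable_fun setT (G : 'rV[R]_n -> mR) ->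
  (forall x t, is_derive t (1 : R) (fun u => f (row_upd x i u)) (G (row_upd x i t))) ->
  (forall x, continuous (fun u => G (row_upd x i u))) ->
  (forall x : 'rV[R]_n, B <= `|x ord0 i| -> f x = 0 /\ G x = 0) ->
  (\int[lebesgue_rV n]_x ((EFin \o G)^\+ x) =
   \int[lebesgue_rV n]_x ((EFin \o G)^\- x))%E.
Proof.
move=> B0; elim: n i f G => [[]//|n IHn] i f G mG fG cG z.
have mEG : measurable_fun setT (EFin \o G) by exact/measurable_EFinP.
have mP := measurable_funepos mEG; have mN := measurable_funeneg mEG.
case: (unliftP ord0 i) => [j ij|i0].
  (* A direction other than the first one survives in each slice, where the induction hypothesis
     applies. *)
  rewrite !integral_rVS//; apply: eq_integral => t _.
  suff : (\int[lebesgue_rV n]_y ((EFin \o (fun y => G (rV_cons (t, y))))^\+ y) =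
      \int[lebesgue_rV n]_y ((EFin \o (fun y => G (rV_cons (t, y))))^\- y))%E.
    have c : EFin \o (fun y => G (rV_cons (t, y))) =
        (EFin \o G) \o (fun y => rV_cons (t, y)) by [].
    by rewrite c funepos_comp funeneg_comp.
  apply: (IHn j (fun y => f (rV_cons (t, y)))).
  - exact: (measurableT_comp mG (measurable_rV_cons2 t)).
  - move=> x u; have := fG (rV_cons (t, x)) u; rewrite ij row_upd_consS.
    by under eq_fun do rewrite row_upd_consS.
  - move=> x; have := cG (rV_cons (t, x)); rewrite ij.
    by under eq_fun do rewrite row_upd_consS.
  - move=> x xB; apply: z; rewrite ij mxE liftK//.
rewrite !integral_rVS_swap//; apply: eq_integral => y _.
(* The first direction is integrated innermost. The entry [0] is a placeholder, overwritten by
   [row_upd]. *)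
have Z (t : R) : B <= `|t| -> f (row_upd (rV_cons (0, y)) i t) = 0 /\
    G (row_upd (rV_cons (0, y)) i t) = 0.
  by move=> Bt; apply: z; rewrite mxE eqxx.
have := @integral_is_derive_cpt R (fun u => f (row_upd (rV_cons (0, y)) i u))
  (fun u => G (row_upd (rV_cons (0, y)) i u)) B B0 (fG _) (cG _)
  (fun t Bt => (Z t Bt).1) (fun t Bt => (Z t Bt).2).
rewrite integralE => h.
have {}h : (\int[lebesgue_measure]_t ((fun t => (G (row_upd (rV_cons (0, y)) i t))%:E)^\+ t) =
   \int[lebesgue_measure]_t ((fun t => (G (row_upd (rV_cons (0, y)) i t))%:E)^\- t))%E.
  (* A difference equal to 0 rules out infinite values, since [+oo - +oo] is [-oo]. *)
  have eq_of_sub0 (p q : \bar R) : (0 <= p -> 0 <= q -> p - q = 0 -> p = q)%E.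
    case: p q => [p| |] [q| |] // _ _; rewrite -EFinB => -[/eqP].
    by rewrite subr_eq0 => /eqP ->.
  by apply: eq_of_sub0 h; exact: integral_ge0.
transitivity (\int[lebesgue_measure]_t ((fun t => (G (row_upd (rV_cons (0, y)) i t))%:E)^\+ t))%E.
  by apply: eq_integral => t _; rewrite !funeposE /= i0 row_upd_cons0.
by rewrite h; apply: eq_integral => t _; rewrite !funenegE /= i0 row_upd_cons0.
Qed.

Lemma integral_partial_test n (i : 'I_n) (Omega : set 'rV[R]_n) f :
  test_function Omega f ->
  (\int[lebesgue_rV n]_x (partial i f x)%:E = 0)%E.
Proof.
move=> tf; have [sf cf _] := tf.
have tp := test_partial i tf.
have [B B0 KB] := compact_box cf.
have KBN (x : 'rV[R]_n) : B <= `|x ord0 i| -> ~ closure [set x | f x != 0] x.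
  by move=> Bx /KB /(_ i); rewrite ltNge Bx.
have tfT : test_function setT (partial i f) by case: tp.
(* Pairing with the constant 1 gives the integrability of [partial i f]. *)
have L1 : L1loc setT (fun _ : 'rV[R]_n => 1 : R).
  by apply: continuous_L1loc => //; exact: cst_continuous.
have I : (lebesgue_rV n).-integrable setT (fun x => (partial i f x)%:E).
  have := integrable_test_mul measurableT L1 tfT.
  by under eq_fun do rewrite mul1r.
have h : (\int[lebesgue_rV n]_x ((EFin \o partial i f)^\+ x) =
    \int[lebesgue_rV n]_x ((EFin \o partial i f)^\- x))%E.
  apply: (@integral_partial_pos_neg n i f (partial i f) B B0).
  - exact: (measurable_smooth (smooth_partial i sf)).
  - by move=> x t; apply/is_derive_row_upd; exact: smooth_derive.
  - move=> x; have cp := smooth_continuous (smooth_partial i sf).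
    move=> t; apply: (@continuous_comp _ _ _ (row_upd x i)); last exact: cp.
    exact: continuous_row_upd.
  - by move=> x /KBN Nx; split; [exact: notin_supp|exact: notin_supp_partial].
transitivity (\int[lebesgue_rV n]_x (EFin \o partial i f) x)%E; first by [].
rewrite integralE h subee//.
by rewrite ge0_fin_numE ?integral_ge0//; exact: integral_funeneg_lt_pinfty.
Qed.

End integration_by_parts.

(** * Sobolev's inequality at the critical exponent for test functions *)

Section sobolev_inequality.
Context {R : realType}.
Local Notation mR := (measurableTypeR R).

Lemma lee_prod (I : Type) (r : seq I) (F G : I -> \bar R) :
  (forall i, 0 <= F i <= G i)%E ->
  (\prod_(i <- r) F i <= \prod_(i <- r) G i)%E.
Proof.
move=> FG; suff /andP[] : (0 <= \prod_(i <- r) F i <= \prod_(i <- r) G i)%E by [].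
elim: r => [|i r /andP[IH0 IH]]; first by rewrite !big_nil lexx lee01.
have /andP[F0 FGi] := FG i.
by rewrite !big_cons mule_ge0//= lee_pmul.
Qed.

Lemma measurable_norm_powR d (T : measurableType d) (f : T -> mR) (r : R) :
  measurable_fun setT f -> measurable_fun setT (fun x => (`|f x| `^ r)%:E).
Proof.
move=> mf; apply/measurable_EFinP; apply: (measurableT_comp (measurable_powR _)).
exact: measurableT_comp.
Qed.

(** A bounded function on a set of finite measure. This finiteness is what allows the critical
    integral to be absorbed in Sobolev's inequality. *)
Lemma integral_test_powR_lty n (Omega : set 'rV[R]_n) w (r : R) :
  test_function Omega w -> 0 < r ->
  (\int[lebesgue_rV n]_x (`|w x| `^ r)%:E < +oo)%E.
Proof.
move=> tw r0; have [sw cw _] := tw; have [M M0 wM] := test_bounded tw.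
set K := closure _ in cw; have mK := compact_measurable_rV cw.
rewrite (_ : \int[_]_x _ = \int[lebesgue_rV n]_(x in K) (`|w x| `^ r)%:E)%E; last first.
  rewrite [RHS]integral_mkcond; apply: eq_integral => x _.
  rewrite patchE; case: ifPn => //; rewrite notin_setE => /notin_supp ->.
  by rewrite normr0 powR0 ?gt_eqF.
apply: (@le_lt_trans _ _ (\int[lebesgue_rV n]_(x in K) (M `^ r)%:E)%E).
  apply: ge0_le_integral => //.
  - by apply: measurable_funTS; apply: measurable_norm_powR; exact: measurable_smooth.
  - move=> x _; rewrite lee_fin ge0_ler_powR ?nnegrE ?(ltW r0) ?(ltW M0)//.
rewrite integral_cst//; apply: lte_mul_pinfty => //.
  by rewrite lee_fin powR_ge0.
exact: compact_finite_measure_rV.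
Qed.

(* The exponent of [a] on the right is less than 1, so that [a] is absorbed. *)
Lemma sobolev_absorb (a b c N s : R) : 0 <= a -> 0 <= b -> 0 < c ->
  1 < s -> s < N ->
  a <= (c * (a `^ (1 - s^-1) * b `^ s^-1)) `^ (N / (N - 1)) ->
  a <= (c `^ s * b) `^ (N / (N - s)).
Proof.
move=> + b0 c0 s1 sN; rewrite le_eqVlt => /predU1P[<- _|a0]; first exact: powR_ge0.
have s0 : 0 < s by exact: lt_trans s1.
have N1 : 0 < N - 1 by rewrite subr_gt0 (lt_trans s1).
have Ns : 0 < N - s by rewrite subr_gt0.
(* [t] is chosen so that the total exponent of [a] on the right is [1 - t]; cancelling [a ^ (1 - t)]
   leaves [a ^ t], and the power [1 / t] gives the claim. *)
set e := N / (N - 1); pose t := (N - s) / (s * (N - 1)).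
have N0 : 0 < N by exact: lt_trans sN.
have t0 : 0 < t by rewrite divr_gt0// mulr_gt0.
have e0 : 0 < e by rewrite divr_gt0.
have te : (1 - s^-1) * e = 1 - t.
  by rewrite /e /t; field; rewrite !gt_eqF.
have b1 := powR_ge0 b s^-1; have a1 := powR_ge0 a (1 - s^-1).
rewrite (powRM _ (ltW c0) (mulr_ge0 a1 b1)) (powRM _ a1 b1) -!powRrM te => h.
have {}h : a `^ t <= (c `^ s * b) `^ (s^-1 * e).
  rewrite (powRM _ (powR_ge0 _ _) b0) -powRrM mulrA divff ?gt_eqF// mul1r.
  rewrite -(ler_pM2r (powR_gt0 (1 - t) a0)) -powRD ?(gt_eqF a0) ?implybT//.
  rewrite addrCA subrr addr0 powRr1 ?(ltW a0)//.
  by rewrite mulrAC -mulrA.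
have := ge0_ler_powR (r := t^-1) (ltW _) _ _ h; rewrite invr_gt0 !nnegrE !powR_ge0.
move=> /(_ t0 isT isT); rewrite -!powRrM divff ?gt_eqF// powRr1 ?(ltW a0)//.
move=> /le_trans; apply; rewrite le_eqVlt; apply/orP; left; apply/eqP.
by congr (_ `^ _); rewrite /e /t; field; rewrite !gt_eqF.
Qed.

Theorem sobolev_test n (Omega : set 'rV[R]_n.+1) w (s : R) :
  test_function Omega w -> (0 < n)%N -> 1 < s -> s < n.+1%:R ->
  (\int[lebesgue_rV n.+1]_x (`|w x| `^ (s * n.+1%:R / (n.+1%:R - s)))%:E <=
   (((s * n%:R / (n.+1%:R - s)) `^ s)%:E *
     \int[lebesgue_rV n.+1]_x ((\sum_(i < n.+1) `|partial i w x|) `^ s)%:E)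
     `^ (n.+1%:R / (n.+1%:R - s)))%E.
Proof.
move=> tw n0 s1 sN; have [sw cw _] := tw.
set N : R := n.+1%:R in sN *; set q := s * N / (N - s).
(* This exponent satisfies both [g * N / n = q], needed after the Loomis-Whitney step, and
   [g - 1 = q * (1 - 1 / s)], needed for Hölder's inequality to return the integral of [|w| ^ q]. *)
set g := s * n%:R / (N - s).
have nE : n%:R = N - 1 :> R by rewrite /N -natr1 addrK.
have s0 : 0 < s by exact: lt_trans s1.
have Ns : 0 < N - s by rewrite subr_gt0.
have nr0 : 0 < n%:R :> R by rewrite ltr0n.
have N0 : 0 < N by rewrite ltr0n.
have g0 : 0 < g by rewrite divr_gt0// mulr_gt0.
have q0 : 0 < q by rewrite divr_gt0// mulr_gt0.
have g1 : 1 < g.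
  rewrite /g nE ltr_pdivlMr// mul1r ltrBlDr mulrBr mulr1 subrK.
  by rewrite ltr_pMl.
pose F x := \sum_(i < n.+1) `|partial i w x|.
have F0 x : 0 <= F x by exact: sumr_ge0.
have mw : measurable_fun setT (w : _ -> mR) by exact: measurable_smooth.
have mF : measurable_fun setT (F : _ -> mR).
  apply: measurable_sum => i; apply: measurableT_comp => //.
  by apply: measurable_smooth; exact: smooth_partial.
(* A single function dominating the derivative of [|w| ^ g] in every coordinate direction. *)
pose f x := (g * (`|w x| `^ (g - 1) * F x))%:E.
have f0 x : (0 <= f x)%E.
  by rewrite lee_fin mulr_ge0 ?(ltW g0)// mulr_ge0 ?powR_ge0.
have mf : measurable_fun setT f.
  apply/measurable_EFinP; apply: measurable_funM => //.
  apply: measurable_funM => //; apply: (measurableT_comp (measurable_powR _)).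
  exact: measurableT_comp.
have [B B0 KB] := compact_box cw.
have line i x : ((`|w x| `^ g)%:E <= line_integral i f x)%E.
  have D t : is_derive t (1 : R) (fun u => w (row_upd x i u))
      (partial i w (row_upd x i t)).
    by apply/is_derive_row_upd; exact: smooth_derive.
  have C : continuous (fun u => partial i w (row_upd x i u)).
    have cp := smooth_continuous (smooth_partial i sw).
    move=> t; apply: (@continuous_comp _ _ _ (row_upd x i)); last exact: cp.
    exact: continuous_row_upd.
  have Z (t : R) : t <= - B -> w (row_upd x i t) = 0.
    move=> tB; apply: notin_supp => /KB /(_ i); rewrite mxE eqxx ltNge.
    by rewrite ler_normr lerNr tB orbT.
  have := norm_powR_le_integral (x ord0 i) g1 D C Z.
  rewrite row_upd_id => /le_trans; apply.
  have mru : measurable_fun setT (row_upd x i : mR -> 'rV[R]_n.+1).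
    exact: (measurableT_comp (measurable_row_upd i) (measurable_pair1 x)).
  apply: ge0_le_integral => //.
  - by move=> t _; rewrite lee_fin mulr_ge0 ?(ltW g0)// mulr_ge0 ?powR_ge0.
  - apply/measurable_EFinP; apply: measurable_funM => //; apply: measurable_funM.
      apply: (measurableT_comp (measurable_powR _)); apply: measurableT_comp => //.
      exact: (measurableT_comp mw mru).
    apply: measurableT_comp => //; apply: (measurableT_comp _ mru).
    by apply: measurable_smooth; exact: smooth_partial.
  - exact: (measurableT_comp mf mru).
  - move=> t _; rewrite lee_fin ler_pM2l// ler_wpM2l ?powR_ge0//.
    by rewrite /F (bigD1 i)//= lerDl sumr_ge0.
set A := (\int[lebesgue_rV n.+1]_x (`|w x| `^ q)%:E)%E.
set Fs := (\int[lebesgue_rV n.+1]_x (F x `^ s)%:E)%E.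
have A0 : (0 <= A)%E by apply: integral_ge0 => x _; rewrite lee_fin powR_ge0.
have Fs0 : (0 <= Fs)%E by apply: integral_ge0 => x _; rewrite lee_fin powR_ge0.
have p0 : 0 < n%:R^-1 :> R by rewrite invr_gt0.
have Aoo : (A < +oo)%E by exact: integral_test_powR_lty tw q0.
have AB : (A <= (\int[lebesgue_rV n.+1]_x f x) `^ (N / (N - 1)))%E.
  have -> : N / (N - 1) = 1 + n%:R^-1.
    by rewrite -nE /N -natr1 mulrDl divff ?gt_eqF// mul1r.
  (* The endpoint [p = 1 / n], at which the factor [f ^ (1 - n p)] is 1. *)
  apply: le_trans (line_integral_prod_le mf f0 p0 _); last by rewrite divff ?gt_eqF.
  apply: ge0_le_integral => //.
  - exact: measurable_norm_powR.
  - apply: emeasurable_funM; first exact: (measurableT_comp (measurable_poweR _)).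
    apply: emeasurable_prod => i; apply: (measurableT_comp (measurable_poweR _)).
    exact: measurable_line_integral.
  - move=> x _; rewrite divff ?gt_eqF// subrr poweRe0 mul1e.
    (* [|w| ^ q] is a product of [n.+1] equal factors [(|w| ^ g) ^ (1 / n)], one for each
       direction. *)
    apply: (@le_trans _ _ (\prod_(i < n.+1) ((`|w x| `^ g)%:E `^ n%:R^-1))%E).
      rewrite -poweR_prod; last by move=> _; rewrite lee_fin powR_ge0.
      have -> : (\prod_(i < n.+1) (`|w x| `^ g)%:E = (`|w x| `^ (g * N))%:E)%E.
        rewrite powRrM powR_mulrn ?powR_ge0//.
        elim: n.+1 => [|m IHm]; first by rewrite big_ord0 expr0.
        by rewrite big_ord_recl IHm exprS EFinM.
      rewrite poweR_EFin -powRrM (_ : g * N / n%:R = q)//.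
      have E (m M d : R) : m != 0 -> d != 0 -> s * m / d * M / m = s * M / d.
        by move=> m0 d0; field; rewrite m0 d0.
      by rewrite /g /q E// gt_eqF.
    apply: lee_prod => i; rewrite poweR_ge0 andTb.
    apply: gt0_ler_poweR; rewrite ?(ltW p0)//.
    + by rewrite in_itv/= lee_fin powR_ge0 leey.
    + by rewrite in_itv/= leey andbT; exact: line_integral_ge0.
have ps : 0 < s^-1 < 1 by rewrite invr_gt0 s0 invf_lt1.
have fA : (\int[lebesgue_rV n.+1]_x f x <= g%:E * (A `^ (1 - s^-1) * Fs `^ s^-1))%E.
  have mq : measurable_fun setT (fun x => (`|w x| `^ q)%:E) by exact: measurable_norm_powR.
  have mFs : measurable_fun setT (fun x => (F x `^ s)%:E).
    by apply/measurable_EFinP; exact: (measurableT_comp (measurable_powR _)).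
  have q00 x : (0 <= (`|w x| `^ q)%:E)%E by rewrite lee_fin powR_ge0.
  have Fs00 x : (0 <= (F x `^ s)%:E)%E by rewrite lee_fin powR_ge0.
  have := hoelder_poweR (lebesgue_rV n.+1) mq mFs q00 Fs00 ps.
  rewrite -(@lee_pmul2l _ g%:E)// ?lte_fin// -ge0_integralZl//; last 3 first.
  - by apply: emeasurable_funM; exact: (measurableT_comp (measurable_poweR _)).
  - by move=> x _; rewrite mule_ge0 ?poweR_ge0.
  - by rewrite lee_fin ltW.
  apply: le_trans; rewrite le_eqVlt; apply/orP; left; apply/eqP.
  apply: eq_integral => x _; rewrite /f !poweR_EFin -!EFinM -!powRrM.
  congr (g * (_ `^ _ * _))%:E; last by rewrite divff ?gt_eqF// powRr1.
  have E (M : R) : M - s != 0 ->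
      s * (M - 1) / (M - s) - 1 = s * M / (M - s) * (1 - s^-1).
    by move=> Ms; field; rewrite Ms gt_eqF.
  by rewrite /g /q nE E// gt_eqF.
have {}AB : (A <= (g%:E * (A `^ (1 - s^-1) * Fs `^ s^-1)) `^ (N / (N - 1)))%E.
  apply: (le_trans AB); apply: gt0_ler_poweR => //.
  - by rewrite divr_ge0 ?(ltW N0)// -nE ltW.
  - by rewrite in_itv/= leey andbT integral_ge0.
  - by rewrite in_itv/= leey andbT !mule_ge0 ?poweR_ge0// lee_fin ltW.
(* If [Fs] is infinite, so is the right-hand side; otherwise [A] and [Fs] are both real and
   [sobolev_absorb] applies. *)
have [Fsoo|Fsoo] := eqVneq Fs +oo%E.
  rewrite Fsoo gt0_muley ?lte_fin ?powR_gt0// poweRyr ?leey//.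
  by rewrite gt_eqF// divr_gt0.
move: A0 Fs0 Aoo Fsoo AB; clear fA; clearbody A Fs.
case: A => [a| |]//; case: Fs => [b| |]// a0 b0 _ _ AB.
rewrite lee_fin in a0; rewrite lee_fin in b0.
exact: (sobolev_absorb a0 b0 g0 s1 sN AB).
Qed.

End sobolev_inequality.

(** * Weak derivatives of test functions and of differences *)

Section weak_partial.
Context {R : realType} {n : nat}.
Variable Omega : set 'rV[R]_n.
Hypothesis mO : measurable Omega.
Local Notation mR := (measurableTypeR R).
Local Notation mu := (lebesgue_rV n : {measure set 'rV[R]_n -> \bar R}).
Implicit Types (u v f g h W G phi : 'rV[R]_n -> R) (i : 'I_n).

Lemma L1loc_sub u v : L1loc Omega u -> L1loc Omega v -> L1loc Omega (u \- v).
Proof.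
move=> [mu_ iu] [mv iv]; split; first exact: measurable_funB.
move=> K cK KO; have mK := compact_measurable_rV cK.
have muK : measurable_fun K u by exact: measurable_funS mu_.
have mvK : measurable_fun K v by exact: measurable_funS mv.
have I (w : 'rV[R]_n -> R) : measurable_fun K w -> (\int[mu]_(x in K) `|w x|%:E < +oo)%E ->
    mu.-integrable K (EFin \o w).
  by move=> mw iw; apply/integrableP; split; [exact/measurable_EFinP|].
have : mu.-integrable K ((EFin \o u) \- (EFin \o v))%E.
  by apply: integrableB => //; apply: I => //; [exact: iu|exact: iv].
by move=> /integrableP[_].
Qed.

(** The product rule for [W * phi], whose partial derivative has integral zero over the whole space;
    outside [Omega] both terms vanish with [W] and its derivative. *)
Lemma is_weak_partial_test i W : test_function Omega W ->
  is_weak_partial Omega i W (partial i W).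
Proof.
move=> tW; have [sW cW WO] := tW; have tdW := test_partial i tW.
have LW : L1loc Omega W by apply: continuous_L1loc => //; exact: smooth_continuous.
have LdW : L1loc Omega (partial i W).
  by apply: continuous_L1loc => //; apply: smooth_continuous; exact: smooth_partial.
split=> // phi tphi; have [sphi _ _] := tphi.
have I1 := integrable_test_mul mO LW (test_partial i tphi).
have I2 := integrable_test_mul mO LdW tphi.
have := integral_partial_test i (test_mulr tW sphi).
have -> : (\int[lebesgue_rV n]_x (partial i (fun x => W x * phi x) x)%:E =
    \int[mu]_(x in Omega) ((W x * partial i phi x)%:E + (partial i W x * phi x)%:E))%E.
  rewrite [RHS]integral_mkcond; apply: eq_integral => x _.
  rewrite partialM// patchE; case: ifPn => [_|]; first by rewrite -EFinD (mulrC (partial _ _ _)).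
  rewrite notin_setE => xO; have NW : ~ closure [set x | W x != 0] x by move=> /WO.
  by rewrite (notin_supp NW) (notin_supp_partial i NW) mulr0 mul0r addr0.
rewrite integralD// => h; rewrite /Rintegral.
move: h; have := integrable_fin_num mO I1; have := integrable_fin_num mO I2.
case: (\int[mu]_(x in Omega) (W x * partial i phi x)%:E)%E => // a.
case: (\int[mu]_(x in Omega) (partial i W x * phi x)%:E)%E => // b _ _.
by rewrite -EFinD => -[/eqP]; rewrite addr_eq0 => /eqP.
Qed.

Lemma is_weak_partialB i u v g h : is_weak_partial Omega i u g ->
  is_weak_partial Omega i v h -> is_weak_partial Omega i (u \- v) (g \- h).
Proof.
move=> [Lu Lg ug] [Lv Lh vh]; split; [exact: L1loc_sub..|] => phi tphi.
have tp := test_partial i tphi.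
under eq_Rintegral do rewrite /= mulrBl.
under [X in _ = - X]eq_Rintegral do rewrite /= mulrBl.
rewrite !RintegralB//; try exact: integrable_test_mul.
by rewrite ug// vh// opprB opprK addrC.
Qed.

(** Both sides are minus the pairing of [W] with [partial i h]. This takes the place of the almost
    everywhere uniqueness of weak derivatives. *)
Lemma integral_weak_partial i W G h : test_function Omega W ->
  is_weak_partial Omega i W G -> test_function Omega h ->
  (\int[mu]_(x in Omega) (partial i W x * h x)%:E =
   \int[mu]_(x in Omega) (G x * h x)%:E)%E.
Proof.
move=> tW [_ LG WG] th; have [_ LdW Wd] := is_weak_partial_test i tW.
have I1 := integrable_test_mul mO LG th.
have I2 := integrable_test_mul mO LdW th.
have := WG _ th; rewrite (Wd _ th) => /oppr_inj; rewrite /Rintegral => h12.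
rewrite -[LHS]fineK; last exact: integrable_fin_num.
rewrite -[RHS]fineK; last exact: integrable_fin_num.
by congr EFin.
Qed.

End weak_partial.

(** * Pointwise estimates for the smoothed duality map *)

Section duality.
Context {R : realType}.

(* [dual_fun s m d t] is a smooth substitute for [sg t * |t| ^ (s - 1)]. *)
Definition dual_fun (s : R) (m : nat) (d t : R) : R :=
  t ^+ (m.*2.+1) * (t ^+ 2 + d ^+ 2) `^ (- ((m.*2.+2)%:R - s) / 2).

Variables (s : R) (m : nat).
Hypotheses (s1 : 1 < s) (ms : s <= m.*2.+2%:R).

(** The bound on [s] makes the exponent [- q] nonpositive, so the second factor of [dual_fun]
    decreases in [d > 0]. For [d = 0] the total degree in [t] would be [2 m + 1 - 2 q = s - 1]. *)
Let q : R := (m.*2.+2%:R - s) / 2.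
Let q0 : 0 <= q. Proof. by rewrite divr_ge0// subr_ge0. Qed.

Let dual_funE d t : dual_fun s m d t = t ^+ (m.*2.+1) * (t ^+ 2 + d ^+ 2) `^ (- q).
Proof. by rewrite /dual_fun /q mulNr. Qed.

Let sqr_gt0 (d t : R) : 0 < d -> 0 < t ^+ 2 + d ^+ 2.
Proof. by move=> d0; rewrite ltr_wpDl ?sqr_ge0// exprn_gt0. Qed.

Lemma dual_fun0 d : dual_fun s m d 0 = 0.
Proof. by rewrite /dual_fun expr0n mul0r. Qed.

Let norm_dual d t : `|dual_fun s m d t| = `|t| ^+ (m.*2.+1) * (t ^+ 2 + d ^+ 2) `^ (- q).
Proof. by rewrite dual_funE normrM normrX (ger0_norm (powR_ge0 _ _)). Qed.

Lemma mul_dual_fun d t : t * dual_fun s m d t = `|t| * `|dual_fun s m d t|.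
Proof.
rewrite norm_dual dual_funE !mulrA -!exprS; congr (_ * _).
by rewrite -normrX ger0_norm// -doubleS -mul2n exprM exprn_ge0// sqr_ge0.
Qed.

Let powR_sqr (t r : R) : (t ^+ 2) `^ r = `|t| `^ (2 * r).
Proof. by rewrite -real_normK ?num_real// -powR_mulrn// -powRrM. Qed.

Lemma norm_dual_fun_le d t : 0 < d -> `|dual_fun s m d t| <= `|t| `^ (s - 1).
Proof.
move=> d0; have [->|t0] := eqVneq t 0; first by rewrite dual_fun0 normr0 powR_ge0.
have tp : 0 < `|t| by rewrite normr_gt0.
rewrite norm_dual.
apply: (@le_trans _ _ (`|t| ^+ (m.*2.+1) * (t ^+ 2) `^ (- q))).
  rewrite ler_wpM2l ?exprn_ge0// !powRN lef_pV2 ?posrE ?powR_gt0 ?sqr_gt0 ?exprn_even_gt0//.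
  by rewrite ge0_ler_powR ?nnegrE ?sqr_ge0 ?lerDl ?sqr_ge0// ltW// sqr_gt0.
rewrite powR_sqr -powR_mulrn// -powRD ?(gt_eqF tp) ?implybT//.
rewrite le_eqVlt; apply/orP; left; apply/eqP; congr (_ `^ _).
by rewrite /q -(natr1 m.*2.+1); field.
Qed.

(** Young's inequality with exponents [s] and [s' = s / (s - 1)], followed by [|h| ^ s' <= t * h]
    for [h = dual_fun s m d t], a consequence of [norm_dual_fun_le]. The factor [1 - 1 / s < 1]
    permits absorption. *)
Lemma dual_fun_young d t y : 0 < d ->
  y * dual_fun s m d t <= `|y| `^ s / s + (1 - s^-1) * (t * dual_fun s m d t).
Proof.
move=> d0; set h := dual_fun s m d t.
have s0 : 0 < s by exact: lt_trans s1.
have s10 : 0 < s - 1 by rewrite subr_gt0.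
pose s' := s / (s - 1).
have s'0 : 0 < s' by rewrite divr_gt0.
have s'E : s'^-1 = 1 - s^-1 by rewrite /s'; field; rewrite !gt_eqF.
apply: le_trans (ler_norm _) _; rewrite normrM.
have := @conjugate_powR R `|y| `|h| s s' (normr_ge0 _) (normr_ge0 _) s0 s'0.
rewrite s'E addrC subrK => /(_ erefl) /le_trans; apply.
rewrite lerD2l// mulrC ler_wpM2l//; first by rewrite -s'E invr_ge0 ltW.
rewrite mul_dual_fun -/h.
have -> : s' = 1 + (s - 1)^-1 by rewrite /s'; field; rewrite !gt_eqF.
have [->|h0] := eqVneq h 0.
  by rewrite normr0 mulr0 powR0// gt_eqF// addr_gt0// invr_gt0.
rewrite powRD ?normr_eq0 ?h0 ?implybT// powRr1// mulrC ler_wpM2r//.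
have := norm_dual_fun_le t d0; rewrite -/h => hl.
have := ge0_ler_powR (r := (s - 1)^-1) _ _ _ hl.
rewrite !nnegrE powR_ge0 normr_ge0 invr_ge0 (ltW s10) => /(_ isT isT isT).
by rewrite -powRrM divff ?gt_eqF// powRr1.
Qed.

(** If [|t| <= d], the last term suffices; if [|t| > d], then [t ^ 2 + d ^ 2 <= 2 t ^ 2], at the
    cost of the factor [2 ^ q]. *)
Lemma norm_powR_le_dual d t : 0 < d ->
  `|t| `^ s <= 2 `^ q * (t * dual_fun s m d t) + d `^ s.
Proof.
move=> d0; have s0 : 0 < s by exact: lt_trans s1.
have [td|dt] := leP `|t| d.
  rewrite -[leLHS]add0r lerD//.
    by rewrite mul_dual_fun mulr_ge0 ?powR_ge0// mulr_ge0.
  by rewrite ge0_ler_powR ?nnegrE// ltW.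
have tp : 0 < `|t| by exact: lt_trans dt.
have t0 : t != 0 by rewrite -normr_gt0.
rewrite -[leLHS]addr0 lerD ?powR_ge0// mul_dual_fun norm_dual mulrA -exprS.
apply: (@le_trans _ _ (2 `^ q * (`|t| ^+ (m.*2.+2) * (2 * t ^+ 2) `^ (- q)))).
  have tt : (t ^+ 2) `^ (- q) = `|t| `^ (s - m.*2.+2%:R).
    by rewrite powR_sqr; congr (_ `^ _); rewrite /q; field.
  have qq : 2 `^ q * 2 `^ (- q) = 1 :> R by rewrite powRN mulfV ?gt_eqF ?powR_gt0.
  rewrite powRM ?sqr_ge0// tt mulrA mulrACA qq mul1r.
  rewrite -powR_mulrn// -powRD ?(gt_eqF tp) ?implybT//.
  by rewrite addrC subrK.
rewrite ler_wpM2l ?powR_ge0// ler_wpM2l ?exprn_ge0//.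
have t2 : 0 < t ^+ 2 by rewrite exprn_even_gt0.
have t22 : 0 < 2 * t ^+ 2 by rewrite pmulr_rgt0.
have td2 : 0 < t ^+ 2 + d ^+ 2 by exact: sqr_gt0.
rewrite !powRN lef_pV2 ?posrE ?powR_gt0//.
apply: ge0_ler_powR; rewrite ?nnegrE ?(ltW t22) ?(ltW td2)//.
rewrite mulr_natl mulr2n lerD2l -[leRHS]real_normK ?num_real//.
by rewrite ler_sqr ?nnegrE// ltW.
Qed.

Lemma smooth_dual_fun n (f : 'rV[R]_n -> R) d : 0 < d -> smooth f ->
  smooth (fun x => dual_fun s m d (f x)).
Proof.
move=> d0 sf; apply: smoothM; first exact: smoothX.
apply: smooth_powR => [x|]; first exact: sqr_gt0.
by apply: smoothD; [exact: smoothX|exact: smooth_cst].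
Qed.

Lemma test_dual_fun n (Omega : set 'rV[R]_n) (f : 'rV[R]_n -> R) d : 0 < d ->
  test_function Omega f -> test_function Omega (fun x => dual_fun s m d (f x)).
Proof.
move=> d0 tf; have [sf _ _] := tf.
apply: (test_function_supp tf); first exact: smooth_dual_fun.
by move=> x /notin_supp ->; rewrite dual_fun0.
Qed.

End duality.

(** * Classical derivatives of test functions bounded by arbitrary weak ones *)

Section weak_gradient_bound.
Context {R : realType}.
Local Notation mR := (measurableTypeR R).

Lemma sum_powR_le n (a : 'I_n.+1 -> R) (s : R) : 0 <= s -> (forall i, 0 <= a i) ->
  (\sum_i a i) `^ s <= n.+1%:R `^ s * \sum_i (a i `^ s).
Proof.
move=> s0 a0; pose j := [arg max_(i > ord0) a i]%O.
have aj i : a i <= a j by rewrite /j; case: Order.TotalTheory.arg_maxP => // k _ h; exact: h.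
have sj : \sum_i a i <= n.+1%:R * a j.
  apply: (@le_trans _ _ (\sum_(i < n.+1) a j)); first exact: ler_sum.
  by rewrite sumr_const card_ord mulr_natl.
apply: (@le_trans _ _ ((n.+1%:R * a j) `^ s)).
  by rewrite ge0_ler_powR ?nnegrE ?sumr_ge0 ?mulr_ge0.
rewrite powRM// ler_wpM2l ?powR_ge0// (bigD1 j)//= lerDl.
by apply: sumr_ge0 => i _; exact: powR_ge0.
Qed.

Lemma normB3_powR_le (a b c s : R) : 0 <= s ->
  `|a - (b - c)| `^ s <= 3 `^ s * (`|a| `^ s + (`|b| `^ s + `|c| `^ s)).
Proof.
move=> s0; pose F (i : 'I_3) := nth 0 [:: `|a|; `|b|; `|c|] i.
have := @sum_powR_le 2 F s s0.
rewrite !big_ord_recl !big_ord0/= /F/= !addr0 => h.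
apply: le_trans (h _); last by case=> [[|[|[|k]]]] //=.
apply: ge0_ler_powR; rewrite ?nnegrE ?addr_ge0//.
by rewrite (le_trans (ler_normB _ _))// lerD2l ler_normB.
Qed.

(** [partial i W] and [G] are tested against [dual_fun] of [partial i W], itself a test function.
    The constant is that of [norm_powR_le_dual], whose error term vanishes as [d] tends to 0. *)
Lemma integral_partial_le n (Omega : set 'rV[R]_n) i W G (s : R) (m : nat) :
  measurable Omega -> 1 < s -> s <= m.*2.+2%:R ->
  test_function Omega W -> is_weak_partial Omega i W G ->
  (\int[lebesgue_rV n]_x (`|partial i W x| `^ s)%:E <=
   (2 `^ ((m.*2.+2%:R - s) / 2))%:E *
   \int[lebesgue_rV n]_(x in Omega) (`|G x| `^ s)%:E)%E.
Proof.
move=> mO s1 ms tW wG; set c := 2 `^ _.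
have s0 : 0 < s by exact: lt_trans s1.
have c0 : 0 < c by exact: powR_gt0.
set v := partial i W; have tv : test_function Omega v by exact: test_partial.
have [sv cv vO] := tv; set K := closure _ in cv vO.
have mK : measurable K by exact: compact_measurable_rV.
have muK : (lebesgue_rV n K < +oo)%E by exact: compact_finite_measure_rV.
set I := (\int[lebesgue_rV n]_(x in Omega) (`|G x| `^ s)%:E)%E.
have I0 : (0 <= I)%E by apply: integral_ge0 => x _; rewrite lee_fin powR_ge0.
have [Ioo|Ioo] := eqVneq I +oo%E; first by rewrite Ioo gt0_muley ?leey ?lte_fin.
have [_ LG _] := wG; have [mG _] := LG.
have mGs : measurable_fun Omega (fun x => `|G x| `^ s : mR).
  by apply: (measurableT_comp (measurable_powR _)); exact: measurableT_comp.
have iG : (lebesgue_rV n).-integrable Omega (fun x => (`|G x| `^ s)%:E).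
  apply/integrableP; split; first exact/measurable_EFinP.
  by under eq_integral do rewrite gee0_abs ?lee_fin ?powR_ge0//; rewrite ltey.
have IE : I = (fine I)%:E by rewrite fineK// ge0_fin_numE// ltey.
have Lv : L1loc Omega v by apply: continuous_L1loc => //; exact: smooth_continuous.
have H0 d t : 0 <= t * dual_fun s m d t by rewrite mul_dual_fun mulr_ge0.
have bound d : 0 < d ->
    (\int[lebesgue_rV n]_(x in Omega) (v x * dual_fun s m d (v x))%:E <= I)%E.
  move=> d0; have th := test_dual_fun s m d0 tv.
  have iv := integrable_test_mul mO Lv th.
  have iGh := integrable_test_mul mO LG th.
  set J := (X in (X <= _)%E); have JE : J = (fine J)%:E.
    by rewrite fineK//; exact: integrable_fin_num.
  (* In [J] the factor [partial i W] is exchanged for [G]; Young's inequality then returns [J] with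
     a coefficient below one, and [J] is finite, so [J <= I]. *)
  have : (J <= (s^-1)%:E * I + (1 - s^-1)%:E * J)%E.
    rewrite /I /J -!integralZl// -integralD//; try exact: integrableZl.
    rewrite (integral_weak_partial mO tW wG th).
    apply: le_integral => //.
      by apply: integrableD => //; exact: integrableZl.
    move=> x _; rewrite -!EFinM -EFinD lee_fin (mulrC s^-1).
    exact: dual_fun_young.
  rewrite IE JE -!EFinM -EFinD !lee_fin => h.
  have {}h : s^-1 * fine J <= s^-1 * fine I.
    by move: h; rewrite mulrBl mul1r addrCA lerDl subr_ge0.
  by move: h; rewrite ler_pM2l// invr_gt0.
apply/lee_addgt0Pr => e e0.
pose k := fine (lebesgue_rV n K).
have k0 : 0 <= k by exact: fine_ge0.
have kE : lebesgue_rV n K = k%:E by rewrite /k fineK// ge0_fin_numE.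
(* Chosen so that [d ^ s] times the measure [k] of the support is at most [e]; the [+ 1] covers a
   null support. *)
pose d := (e / (k + 1)) `^ s^-1.
have ek : 0 < e / (k + 1) by rewrite divr_gt0// ltr_wpDl.
have d0 : 0 < d by exact: powR_gt0.
have ds : d `^ s = e / (k + 1) by rewrite /d -powRrM mulVf ?gt_eqF// powRr1// ltW.
have mvh : measurable_fun setT (fun x => v x * dual_fun s m d (v x) : mR).
  apply: measurable_funM; first exact: measurable_smooth.
  by apply: measurable_smooth; exact: smooth_dual_fun.
apply: (@le_trans _ _ (\int[lebesgue_rV n]_(x in K)
    (c%:E * (v x * dual_fun s m d (v x))%:E + (d `^ s)%:E))%E).
  rewrite (_ : \int[_]_x _ = \int[lebesgue_rV n]_(x in K) (`|v x| `^ s)%:E)%E.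
    apply: ge0_le_integral => //.
    - by apply: measurable_funTS; apply: measurable_norm_powR; exact: measurable_smooth.
    - apply: emeasurable_funD => //; apply: measurable_funTS.
      by apply: measurable_funeM; exact/measurable_EFinP.
    - by move=> x _; rewrite -EFinM -EFinD lee_fin; exact: norm_powR_le_dual.
  rewrite [RHS]integral_mkcond; apply: eq_integral => x _.
  rewrite patchE; case: ifPn => //; rewrite notin_setE => /notin_supp ->.
  by rewrite normr0 powR0 ?gt_eqF.
have mvhK : measurable_fun K (fun x => (v x * dual_fun s m d (v x))%:E).
  by apply/measurable_EFinP; exact: measurable_funTS.
rewrite ge0_integralD//; last 3 first.
- by move=> x _; rewrite mule_ge0// lee_fin ?(ltW c0).
- exact: measurable_funeM.
- by move=> x _; rewrite lee_fin powR_ge0.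
rewrite ge0_integralZl//; last 2 first.
- by move=> x _; rewrite lee_fin.
- by rewrite lee_fin ltW.
rewrite integral_cst// leeD//.
  rewrite lee_pmul2l// ?lte_fin//; apply: le_trans (bound d d0).
  apply: ge0_subset_integral => //; first by apply/measurable_EFinP; exact: measurable_funTS.
  by move=> x _; rewrite lee_fin.
rewrite [X in (_ * X)%E](_ : _ = k%:E); last exact: kE.
rewrite -EFinM lee_fin ds -mulrA ler_piMr ?(ltW e0)//.
by rewrite mulrC ler_pdivrMr ?mul1r ?lerDl// ltr_wpDl.
Qed.

End weak_gradient_bound.

(** * Gradient of [phi - psi], and the pointwise splitting of [|u| ^ q] *)

Section critical_tail.
Context {R : realType}.
Local Notation mR := (measurableTypeR R).

Lemma integral_powR_Lnorm_on n (Omega : set 'rV[R]_n) (s r : R) f :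
  0 < s -> 0 <= r -> (Lnorm_on Omega s f <= r%:E)%E ->
  (\int[lebesgue_rV n]_(x in Omega) (`|f x| `^ s)%:E <= (r `^ s)%:E)%E.
Proof.
move=> s0 r0; rewrite /Lnorm_on => h.
have : ((Lnorm (lebesgue_rV n : {measure set 'rV[R]_n -> \bar R}) s%:E
    (EFin \o (f \_ Omega))) `^ s <= r%:E `^ s)%E.
  apply: gt0_ler_poweR => //; first exact: ltW.
  - by rewrite in_itv/= leey Lnorm_ge0.
  - by rewrite in_itv/= leey lee_fin r0.
rewrite poweR_Lnorm ?gt_eqF// poweR_EFin; apply: le_trans.
rewrite le_eqVlt; apply/orP; left; apply/eqP.
rewrite [LHS]integral_mkcond; apply: eq_integral => x _.
rewrite /= !patchE; case: ifPn => // _.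
by rewrite normr0 powR0 ?gt_eqF.
Qed.

Lemma weak_partialP n (Omega : set 'rV[R]_n) i u :
  (exists g, is_weak_partial Omega i u g) ->
  is_weak_partial Omega i u (weak_partial Omega i u).
Proof. by case=> g ug; exact: (xgetPex (cst 0) (ex_intro _ g ug)). Qed.

Lemma norm_weak_partial_le n (Omega : set 'rV[R]_n) i u x :
  `|weak_partial Omega i u x| <= weak_grad_norm Omega u x.
Proof.
rewrite /weak_grad_norm -sqrtr_sqr ler_sqrt; last by apply: sumr_ge0 => j _; exact: sqr_ge0.
by rewrite (bigD1 i)//= lerDl sumr_ge0// => j _; exact: sqr_ge0.
Qed.

Lemma integral_weak_partial_le n (Omega : set 'rV[R]_n) i u (s r : R) :
  measurable Omega -> 0 < s -> 0 <= r ->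
  (forall j, exists g, is_weak_partial Omega j u g) ->
  (Lnorm_on Omega s (weak_grad_norm Omega u) <= r%:E)%E ->
  (\int[lebesgue_rV n]_(x in Omega) (`|weak_partial Omega i u x| `^ s)%:E <=
   (r `^ s)%:E)%E.
Proof.
move=> mO s0 r0 wu /(integral_powR_Lnorm_on s0 r0); apply: le_trans.
have mw j : measurable_fun Omega (weak_partial Omega j u : _ -> mR).
  by have [_ [+ _] _] := weak_partialP (wu j).
apply: ge0_le_integral => //.
- apply/measurable_EFinP; apply: (measurableT_comp (measurable_powR _)).
  by apply: measurableT_comp => //; exact: mw.
- apply/measurable_EFinP; apply: (measurableT_comp (measurable_powR _)).
  apply: measurableT_comp => //.
  have -> : weak_grad_norm Omega u =
      fun x => (\sum_(j < n) weak_partial Omega j u x ^+ 2) `^ 2^-1.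
    apply/funext => x; rewrite powR12_sqrt//.
    by apply: sumr_ge0 => j _; exact: sqr_ge0.
  apply: (measurableT_comp (measurable_powR _)).
  by apply: measurable_sum => j; exact: (measurable_funX _ (mw j)).
- move=> x _; rewrite lee_fin ge0_ler_powR ?nnegrE ?(ltW s0)//.
  by rewrite (le_trans (norm_weak_partial_le _ i u x))// ler_norm.
Qed.

(** As [phi - psi = (u - u0) - ((u - phi) - (u0 - psi))], the same combination of the chosen weak
    derivatives is a weak derivative of a test function, and [integral_partial_le] applies to it. In
    the constant, the powers of [n.+1] come from summing over directions and [3 ^ s * 3] from the
    three terms. *)
Lemma integral_grad_test_le n (Omega : set 'rV[R]_n.+1) (s r : R) (m : nat)
    u u0 phi psi :
  measurable Omega -> 1 < s -> s <= m.*2.+2%:R -> 0 <= r ->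
  W1 Omega s u -> W1 Omega s u0 -> test_function Omega phi -> test_function Omega psi ->
  (Lnorm_on Omega s (weak_grad_norm Omega (u \- phi)%R) <= r%:E)%E ->
  (Lnorm_on Omega s (weak_grad_norm Omega (u \- u0)%R) <= r%:E)%E ->
  (Lnorm_on Omega s (weak_grad_norm Omega (u0 \- psi)%R) <= r%:E)%E ->
  (\int[lebesgue_rV n.+1]_x ((\sum_i `|partial i (phi \- psi)%R x|) `^ s)%:E <=
   (n.+1%:R `^ s * (n.+1%:R * (2 `^ ((m.*2.+2%:R - s) / 2) *
     (3 `^ s * 3))) * r `^ s)%:E)%E.
Proof.
move=> mO s1 ms r0 [_ Wu] [_ Wu0] tphi tpsi h1 h2 h3.
have s0 : 0 < s by exact: lt_trans s1.
have tW := test_sub tphi tpsi; have [sW _ _] := tW.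
(* Existence excludes the default value 0 of [weak_partial], so that the chosen functions are
   genuine weak derivatives. *)
have e1 j : exists g, is_weak_partial Omega j (u \- phi) g.
  by have [g ug _] := Wu j; exists (g \- partial j phi); apply: is_weak_partialB => //;
    exact: is_weak_partial_test.
have e2 j : exists g, is_weak_partial Omega j (u \- u0) g.
  by have [g ug _] := Wu j; have [h uh _] := Wu0 j; exists (g \- h); exact: is_weak_partialB.
have e3 j : exists g, is_weak_partial Omega j (u0 \- psi) g.
  by have [g ug _] := Wu0 j; exists (g \- partial j psi); apply: is_weak_partialB => //;
    exact: is_weak_partial_test.
set c := 2 `^ _; have c0 : 0 <= c by exact: powR_ge0.
have G i : (\int[lebesgue_rV n.+1]_x (`|partial i (phi \- psi)%R x| `^ s)%:E <=
    (c * (3 `^ s * 3 * r `^ s))%:E)%E.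
  have w1 := weak_partialP (e1 i); have w2 := weak_partialP (e2 i).
  have w3 := weak_partialP (e3 i).
  have := is_weak_partialB mO w2 (is_weak_partialB mO w1 w3).
  rewrite (_ : (u \- u0) \- _ = phi \- psi); last by apply/funext => x /=; ring.
  move=> /(integral_partial_le mO s1 ms tW) /le_trans; apply.
  rewrite EFinM lee_wpmul2l ?lee_fin//.
  have mp (f : 'rV[R]_n.+1 -> R) : L1loc Omega f ->
      measurable_fun Omega (fun x => (`|f x| `^ s)%:E).
    move=> [mf _]; apply/measurable_EFinP; apply: (measurableT_comp (measurable_powR _)).
    exact: measurableT_comp.
  have [_ L1 _] := w1; have [_ L2 _] := w2; have [_ L3 _] := w3.
  set g1 := weak_partial Omega i (u \- phi) in L1 *.
  set g2 := weak_partial Omega i (u \- u0) in L2 *.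
  set g3 := weak_partial Omega i (u0 \- psi) in L3 *.
  apply: (@le_trans _ _ (\int[lebesgue_rV n.+1]_(x in Omega)
    ((3 `^ s)%:E * ((`|g2 x| `^ s)%:E + ((`|g1 x| `^ s)%:E + (`|g3 x| `^ s)%:E))))%E).
    apply: ge0_le_integral => //.
    - by apply: mp; do 2 apply: L1loc_sub => //.
    - by apply: measurable_funeM; do 2 (apply: emeasurable_funD; [exact: mp|]); exact: mp.
    - by move=> x _; rewrite -!EFinD -EFinM lee_fin; apply: normB3_powR_le; exact: ltW.
  rewrite ge0_integralZl//; last 2 first.
  - by do 2 (apply: emeasurable_funD; [exact: mp|]); exact: mp.
  - by move=> x _; rewrite !adde_ge0 ?lee_fin ?powR_ge0.
  rewrite -mulrA EFinM lee_wpmul2l ?lee_fin ?powR_ge0//.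
  rewrite ge0_integralD//; last 3 first.
  - exact: mp.
  - by move=> x _; rewrite adde_ge0 ?lee_fin ?powR_ge0.
  - by apply: emeasurable_funD; exact: mp.
  rewrite ge0_integralD//; last 2 first.
  - exact: mp.
  - exact: mp.
  rewrite (_ : 3 * r `^ s = r `^ s + (r `^ s + r `^ s)); last by ring.
  by rewrite !EFinD !leeD//; apply: integral_weak_partial_le.
have mD i : measurable_fun setT (fun x => (`|partial i (phi \- psi)%R x| `^ s)%:E).
  by apply: measurable_norm_powR; apply: measurable_smooth; exact: smooth_partial.
apply: (@le_trans _ _ (\int[lebesgue_rV n.+1]_x
    ((n.+1%:R `^ s)%:E * \sum_(i < n.+1) (`|partial i (phi \- psi)%R x| `^ s)%:E))%E).
  apply: ge0_le_integral => //.
  - by move=> x _; rewrite lee_fin powR_ge0.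
  - apply/measurable_EFinP; apply: (measurableT_comp (measurable_powR _)).
    apply: measurable_sum => i; apply: measurableT_comp => //.
    by apply: measurable_smooth; exact: smooth_partial.
  - by apply: measurable_funeM; exact: emeasurable_sum.
  - by move=> x _; rewrite sumEFin -EFinM lee_fin; apply: sum_powR_le => //; exact: ltW.
rewrite ge0_integralZl//; last 2 first.
- exact: emeasurable_sum.
- by move=> x _; apply: sume_ge0.
rewrite -mulrA EFinM lee_wpmul2l ?lee_fin ?powR_ge0//.
rewrite ge0_integral_sum//.
apply: (@le_trans _ _ (\sum_(i < n.+1) (c * (3 `^ s * 3 * r `^ s))%:E)%E).
  exact: lee_sum.
rewrite sumEFin lee_fin sumr_const card_ord -[leLHS]mulr_natl.
by rewrite le_eqVlt; apply/orP; left; apply/eqP; ring.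
Qed.

Lemma norm_powR_split (u p f M m q s : R) : 0 < q -> 0 < s -> 0 <= M ->
  `|f| <= M -> 2 * M + 1 <= `|u| -> `|u| <= m ->
  `|u| `^ q <= 4 `^ q * `|p - f| `^ q + m `^ q * 4 `^ s * `|u - p| `^ s.
Proof.
move=> q0 s0 M0 fM Mu um.
have u1 : 1 <= `|u| by apply: le_trans Mu; rewrite lerDr mulr_ge0.
have m0 : 0 <= m by exact: le_trans um.
have [h|h] := leP (4 * `|u - p|) `|u|.
  rewrite -[leLHS]addr0 lerD ?mulr_ge0 ?powR_ge0//.
  rewrite -powRM// ge0_ler_powR ?nnegrE ?(ltW q0) ?mulr_ge0//.
  (* Here [|u - p| <= |u| / 4] and [|f| <= M <= |u| / 2], which leaves [|u| / 4 <= |p - f|]. *)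
  have : `|u| <= `|u - p| + (`|p - f| + `|f|).
    rewrite (le_trans _ (lerD (lexx _) (ler_normD _ _)))//.
    by rewrite subrK (le_trans _ (ler_normD _ _))// subrK.
  by lra.
rewrite -[leLHS]add0r lerD ?mulr_ge0 ?powR_ge0//.
rewrite -mulrA -powRM//; apply: (@le_trans _ _ (m `^ q)).
  by rewrite ge0_ler_powR ?nnegrE ?(ltW q0).
(* The [+ 1] in the threshold gives [1 <= |u| < 4 |u - p|], so that the bound [m ^ q] may be
   multiplied by a power at least 1. *)
have : 1 `^ s <= (4 * `|u - p|) `^ s.
  by rewrite ge0_ler_powR ?nnegrE ?mulr_ge0 ?(ltW s0) ?ler01// (le_trans u1)// ltW.
by rewrite powR1 => h1; rewrite ler_peMr ?powR_ge0.
Qed.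

End critical_tail.

(** * Uniform smallness of [phi - psi] and passage to the limit in the tail *)

Section uniform_tail.
Context {R : realType}.
Local Notation mR := (measurableTypeR R).

(** [sobolev_test] combined with [integral_grad_test_le] bounds the integral by [(D * r ^ s) ^ k],
    where [D] and [k] depend only on [n] and [s]; [r] solves [(D * r ^ s) ^ k = eta]. *)
Lemma test_diff_small n (Omega : set 'rV[R]_n.+1) (s eta : R) :
  measurable Omega -> (0 < n)%N -> 1 < s -> s < n.+1%:R -> 0 < eta ->
  exists2 r : R, 0 < r & forall u u0 phi psi,
  W1 Omega s u -> W1 Omega s u0 -> test_function Omega phi -> test_function Omega psi ->
  (Lnorm_on Omega s (weak_grad_norm Omega (u \- phi)%R) <= r%:E)%E ->
  (Lnorm_on Omega s (weak_grad_norm Omega (u \- u0)%R) <= r%:E)%E ->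
  (Lnorm_on Omega s (weak_grad_norm Omega (u0 \- psi)%R) <= r%:E)%E ->
  (\int[lebesgue_rV n.+1]_x
     (`|(phi \- psi)%R x| `^ (s * n.+1%:R / (n.+1%:R - s)))%:E <= eta%:E)%E.
Proof.
move=> mO n0 s1 sN eta0; set N : R := n.+1%:R in sN *.
have s0 : 0 < s by exact: lt_trans s1.
have Ns : 0 < N - s by rewrite subr_gt0.
have N0 : 0 < N by rewrite ltr0n.
have nr0 : 0 < n%:R :> R by rewrite ltr0n.
(* Any [m] with [s <= 2 m + 2] would serve in [dual_fun]. *)
pose m := Num.truncn s.
have ms : s <= m.*2.+2%:R.
  apply: ltW; apply: lt_le_trans (truncnS_gt s) _.
  by rewrite ler_nat -doubleS -addnn leq_addr.
pose c := s * n%:R / (N - s).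
have c0 : 0 < c by rewrite divr_gt0// mulr_gt0.
pose C := N `^ s * (N * (2 `^ ((m.*2.+2%:R - s) / 2) * (3 `^ s * 3))).
have C0 : 0 < C by rewrite !mulr_gt0// powR_gt0.
pose k := N / (N - s); have k0 : 0 < k by rewrite divr_gt0.
pose D := c `^ s * C; have D0 : 0 < D by rewrite mulr_gt0// powR_gt0.
pose tau := eta `^ k^-1; have tau0 : 0 < tau by exact: powR_gt0.
have tD : 0 < tau / D by rewrite divr_gt0.
exists ((tau / D) `^ s^-1); first exact: powR_gt0.
set r := _ `^ s^-1 => u u0 phi psi Wu Wu0 tphi tpsi h1 h2 h3.
have r0 : 0 <= r by exact: powR_ge0.
have rs : r `^ s = tau / D by rewrite /r -powRrM mulVf ?gt_eqF// powRr1// ltW.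
have G := integral_grad_test_le mO s1 ms r0 Wu Wu0 tphi tpsi h1 h2 h3.
apply: le_trans (sobolev_test (test_sub tphi tpsi) n0 s1 sN) _.
rewrite -/N -/c -/k.
have -> : eta%:E = (((c `^ s)%:E * (C * r `^ s)%:E) `^ k)%E.
  rewrite -EFinM poweR_EFin mulrA -/D rs mulrC divfK ?gt_eqF//.
  by rewrite /tau -powRrM mulVf ?gt_eqF// powRr1// ltW.
have I0 : (0 <= \int[lebesgue_rV n.+1]_x
    ((\sum_(i < n.+1) `|partial i (phi \- psi)%R x|) `^ s)%:E)%E.
  by apply: integral_ge0 => x _; rewrite lee_fin powR_ge0.
apply: gt0_ler_poweR; first exact: ltW.
- by rewrite in_itv/= leey andbT mule_ge0// lee_fin powR_ge0.
- by rewrite in_itv/= leey andbT mule_ge0// lee_fin ?mulr_ge0 ?powR_ge0 ?(ltW C0).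
- by rewrite lee_wpmul2l// lee_fin powR_ge0.
Qed.

(** On the part where [|u| <= k], the coefficient [k ^ q * 4 ^ s] of the integral of [|u - phi| ^ s]
    is fixed before [delta] is chosen, so that this term can be made arbitrarily small; monotone
    convergence then removes the cut-off. *)
Lemma integral_tail_le n (Omega : set 'rV[R]_n) (u psi : 'rV[R]_n -> R)
    (M q s eta : R) : measurable Omega -> measurable_fun Omega (u : _ -> mR) ->
  0 < q -> 0 < s -> 0 <= M -> smooth psi -> (forall x, `|psi x| <= M) ->
  (forall delta : R, 0 < delta -> exists phi, [/\ smooth phi,
     (\int[lebesgue_rV n]_(x in Omega) (`|u x - phi x| `^ s)%:E <= delta%:E)%E &
     (\int[lebesgue_rV n]_x (`|phi x - psi x| `^ q)%:E <= eta%:E)%E]) ->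
  (\int[lebesgue_rV n]_(x in [set x | Omega x /\ (2 * M + 1 <= `|u x|)%R])
    (`|u x| `^ q)%:E <= (4 `^ q * eta)%:E)%E.
Proof.
move=> mO mu_ q0 s0 M0 spsi psiM appr.
have mnu : measurable_fun Omega (fun x => `|u x| : mR) by exact: measurableT_comp.
pose E k := Omega `&` (fun x => `|u x|) @^-1` [set` `[2 * M + 1, k%:R]].
have mE k : measurable (E k) by apply: mnu => //; exact: measurable_itv.
have EO k : E k `<=` Omega by move=> x [].
have -> : [set x | Omega x /\ (2 * M + 1 <= `|u x|)%R] = \bigcup_k E k.
  apply/seteqP; split=> x.
    move=> [Ox ux]; exists (Num.truncn `|u x|).+1 => //; split=> //=.
    by rewrite in_itv/= ux/= ltW// truncnS_gt.
  by move=> [k _ [Ox]] /=; rewrite in_itv/= => /andP[].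
have muq : measurable_fun Omega (fun x => (`|u x| `^ q)%:E).
  by apply/measurable_EFinP; exact: (measurableT_comp (measurable_powR _)).
have ndE : nondecreasing_seq E.
  move=> k l kl; rewrite subsetEset => x [Ox] /=; rewrite in_itv/= => /andP[ux uk].
  by split=> //=; rewrite in_itv/= ux (le_trans uk)// ler_nat.
have := @ge0_nondecreasing_set_cvg_integral _ _ _ E (fun x => (`|u x| `^ q)%:E)
  (lebesgue_rV n) ndE mE (fun k => measurable_funS mO (@EO k) muq)
  (fun _ _ _ => powR_ge0 _ _).
move=> cvgE; rewrite -(cvg_lim _ cvgE)//.
apply: lime_le; first by apply/cvg_ex; eexists; exact: cvgE.
apply: nearW => k; apply/lee_addgt0Pr => e e0.
pose c : R := k%:R `^ q * 4 `^ s.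
have c0 : 0 <= c by rewrite mulr_ge0 ?powR_ge0.
have c1 : 0 < c + 1 by rewrite ltr_wpDl.
(* The [+ 1] is there because [c] is 0 for [k = 0]. *)
have [phi [sphi h1 h2]] := appr (e / (c + 1)) (divr_gt0 e0 c1).
have mu1 : measurable_fun Omega (fun x => (`|u x - phi x| `^ s)%:E).
  apply/measurable_EFinP; apply: (measurableT_comp (measurable_powR _)).
  apply: measurableT_comp => //; apply: measurable_funB => //.
  by apply: measurable_funTS; exact: measurable_smooth.
have mp1 : measurable_fun setT (fun x => (`|phi x - psi x| `^ q)%:E).
  apply: measurable_norm_powR.
  by apply: measurable_funB; exact: measurable_smooth.
have mu2 := measurable_funS mO (@EO k) mu1.
have mp2 : measurable_fun (E k) (fun x => (`|phi x - psi x| `^ q)%:E).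
  exact: measurable_funTS.
apply: (@le_trans _ _ (\int[lebesgue_rV n]_(x in E k)
   ((4 `^ q)%:E * (`|phi x - psi x| `^ q)%:E + c%:E * (`|u x - phi x| `^ s)%:E))%E).
  apply: ge0_le_integral => //.
  - exact: measurable_funS muq.
  - by apply: emeasurable_funD; exact: measurable_funeM.
  - move=> x [_] /=; rewrite in_itv/= => /andP[ux uk].
    by rewrite -!EFinM -EFinD lee_fin; exact: (norm_powR_split _ q0 s0 M0 (psiM x)).
rewrite ge0_integralD//; last 3 first.
- exact: measurable_funeM.
- by move=> x _; rewrite mule_ge0 ?lee_fin ?powR_ge0.
- exact: measurable_funeM.
rewrite ge0_integralZl//.
rewrite [X in (_ + X)%E]ge0_integralZl//.
apply: leeD.
  rewrite EFinM lee_wpmul2l ?lee_fin ?powR_ge0//; apply: le_trans h2.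
  by apply: ge0_subset_integral => // x _; rewrite lee_fin powR_ge0.
apply: (@le_trans _ _ (c%:E * (e / (c + 1))%:E)%E).
  rewrite lee_wpmul2l ?lee_fin//; apply: le_trans h1.
  by apply: ge0_subset_integral => // x _; rewrite lee_fin powR_ge0.
rewrite -EFinM lee_fin mulrCA ler_piMr ?(ltW e0)//.
by rewrite ler_pdivrMr// mul1r lerDl.
Qed.

End uniform_tail.

(** * Choice of the threshold and of the radius *)

Theorem lemma1p2 (R : realType) (N : nat) (hN : (2 <= N)%N)
    (Omega : set 'rV[R]_N) (hOmega : smooth_bounded_domain Omega)
    (s : R) (hs1 : 1 < s) (hsN : s < N%:R) :
  let sstar := s * N%:R / (N%:R - s) in
  forall (eps : R), 0 < eps ->
  forall u0 : 'rV[R]_N -> R, W10 Omega s u0 ->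
  exists sigma r : R, [/\ 0 < sigma, 0 < r &
    forall u : 'rV[R]_N -> R, W10_ball Omega s u0 r u ->
    (\int[lebesgue_rV N]_(x in [set x | Omega x /\ (sigma <= `|u x|)%R])
       (`|u x| `^ sstar)%:E < eps%:E)%E].
Proof.
case: N hN Omega hOmega hsN => [|n] hN Omega hOmega hsN //.
move=> sstar eps eps0 u0 W10u0.
have n0 : (0 < n)%N by [].
have [oO _ _ _ _] := hOmega; have mO := rV_open_measurable oO.
have s0 : 0 < s by exact: lt_trans hs1.
have q0 : 0 < sstar by rewrite divr_gt0 ?subr_gt0// mulr_gt0// ltr0n.
have p0 : 0 < 4 `^ sstar :> R by exact: powR_gt0.
(* The tail bound [4 ^ sstar * eta] is then [eps / 2], which leaves room for the strict
   inequality. *)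
pose eta := eps / 2 / 4 `^ sstar.
have eta0 : 0 < eta by rewrite !divr_gt0.
have [r r0 Hr] := test_diff_small mO n0 hs1 hsN eta0.
have W1_norm_le (f : 'rV[R]_n.+1 -> R) (e : R) : (W1_norm Omega s f < e%:E)%E ->
    (Lnorm_on Omega s f <= e%:E)%E /\
    (Lnorm_on Omega s (weak_grad_norm Omega f) <= e%:E)%E.
  move=> h; split; apply: ltW; apply: le_lt_trans h.
    by rewrite /W1_norm leeDl// Lnorm_ge0.
  by rewrite /W1_norm leeDr// Lnorm_ge0.
(* [psi], and with it the bound [M] and the threshold, is fixed before [u] is introduced; this is
   the uniformity over the ball. *)
have [W1u0 /(_ r r0)[psi tpsi /W1_norm_le[_ psir]]] := W10u0.
have [M M0 psiM] := test_bounded tpsi.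
exists (2 * M + 1), r; split=> //; first by rewrite addr_gt0// mulr_gt0.
move=> u [[W1u Au] ur].
apply: (@le_lt_trans _ _ (4 `^ sstar * eta)%:E); last first.
  rewrite lte_fin /eta mulrC divfK ?gt_eqF//.
  by rewrite ltr_pdivrMr// ltr_pMr// ltr1n.
have mu_ : measurable_fun Omega (u : _ -> measurableTypeR R).
  by have [_ /(_ ord0)[g [[+ _] _ _] _]] := W1u.
have [spsi _ _] := tpsi.
apply: (@integral_tail_le _ _ _ _ psi M _ s) => //; first exact: ltW.
(* One [phi] has to serve twice: its gradient is within [r] of that of [u], and the integral of
   [|u - phi| ^ s] is at most [delta]. *)
move=> delta d0; pose d := Num.min r (delta `^ s^-1).
have d_gt0 : 0 < d by rewrite lt_min r0 powR_gt0.
have [phi tphi /W1_norm_le[h1 h2]] := Au d d_gt0.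
have [sphi _ _] := tphi.
exists phi; split=> //.
  have -> : delta = (delta `^ s^-1) `^ s.
    by rewrite -powRrM mulVf ?gt_eqF// powRr1// ltW.
  apply: (integral_powR_Lnorm_on (f := u \- phi)) => //; first exact: powR_ge0.
  by apply: le_trans h1 _; rewrite lee_fin ge_min lexx orbT.
apply: (Hr u u0 phi psi) => //.
by apply: le_trans h2 _; rewrite lee_fin ge_min lexx.
Qed.
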